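(* Let $T^*$ be an $\omega_1$-Aronszajn tree with no stationary antichain, and assume $\mathsf{PFA}(T^* )$. Let $\mathbb{P}$ be the forcing poset whose conditions are finite antichains of $T^*$, ordered by reverse inclusion. Then $\mathbb{P}$ is Knaster but not stationarily Knaster.
   Context: An $\omega_1$-tree is a tree of height $\omega_1$ all of whose levels are countable; it is an $\omega_1$-Aronszajn tree if it has no uncountable chain. An antichain of a tree is a set of pairwise incomparable nodes. For a tree $T$ of height $\omega_1$, a stationary antichain of $T$ is an antichain $A \subseteq T$ such that $\{\mathrm{ht}_T(x) : x \in A\}$ is a stationary subset of $\omega_1$. A forcing poset $\mathbb{P}$ is $T^*$-preserving if $\mathbb{P}$ forces that $T^*$ is an $\omega_1$-Aronszajn tree with no stationary antichain. $\mathsf{PFA}(T^* )$ is the statement: for every proper $T^*$-preserving forcing poset $\mathbb{P}$ and every sequence $\langle D_\alpha : \alpha < \omega_1\rangle$ of dense subsets of $\mathbb{P}$, there is a filter $G$ on $\mathbb{P}$ with $G \cap D_\alpha \neq \emptyset$ for all $\alpha < \omega_1$. A subset of a forcing poset is linked if any two of its members are compatible (have a common lower bound). A forcing poset $\mathbb{P}$ is Knaster if for every family $\{p_i : i < \omega_1\}$ of conditions there is an uncountable $X \subseteq \omega_1$ such that $\{p_i : i \in X\}$ is linked. It is stationarily Knaster if for every family $\{p_i : i \in S\}$ of conditions, where $S \subseteq \omega_1$ is stationary, there is a stationary set $T \subseteq S$ such that $\{p_i : i \in T\}$ is linked. *)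

(* Defs.v *)
From HB Require Import structures.
From mathcomp Require Import all_boot all_order.
From mathcomp Require Import boolp classical_sets functions cardinality.
Set Implicit Arguments. Unset Strict Implicit. Unset Printing Implicit Defensive.

Local Open Scope classical_set_scope.
Local Open Scope order_scope.

(** * omega_1, clubs and stationary sets *)

Definition well_ordered d (T : porderType d) (A : set T) : Prop :=
  forall B : set T, B `<=` A -> B !=set0 ->
    exists m : T, B m /\ forall y, B y -> m <= y.

(* [W] is (order isomorphic to) the first uncountable ordinal. *)
Definition is_omega1 d (W : orderType d) : Prop :=
  [/\ well_ordered [set: W],
      ~ countable [set: W] &
      forall a : W, countable [set b : W | b < a]].

(* The two premises of the last clause say that [a] is a limit of [C]. *)
Definition club d (W : orderType d) (C : set W) : Prop :=
  (forall a, exists b, a < b /\ C b) /\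
  (forall a, (exists b, b < a) ->
     (forall b, b < a -> exists c, [/\ b < c, c < a & C c]) -> C a).

Definition stationary d (W : orderType d) (S : set W) : Prop :=
  forall C : set W, club C -> exists a, S a /\ C a.

(** * Trees *)

(* The order type of the set of predecessors of [x] is [a]. *)
Definition has_height dW (W : orderType dW) d (T : porderType d)
    (x : T) (a : W) : Prop :=
  exists f : T -> W,
    set_bij [set y | y < x] [set b | b < a] f /\
    forall y z, y < x -> z < x -> (y < z <-> f y < f z).

Definition omega1_tree dW (W : orderType dW) d (T : porderType d) : Prop :=
  [/\ forall x : T, well_ordered [set y : T | y < x],
      forall x : T, exists a : W, has_height x a,
      forall a : W, exists x : T, has_height x a &
      forall a : W, countable [set x : T | has_height x a]].

Definition is_chain d (T : porderType d) (A : set T) : Prop :=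
  forall x y, A x -> A y -> x >=< y.

Definition is_antichain d (T : porderType d) (A : set T) : Prop :=
  forall x y, A x -> A y -> x <> y -> ~ (x >=< y).

Definition aronszajn_tree dW (W : orderType dW) d (T : porderType d) : Prop :=
  omega1_tree W T /\ forall A : set T, is_chain A -> countable A.

Definition stationary_antichain dW (W : orderType dW) d (T : porderType d)
    (A : set T) : Prop :=
  is_antichain A /\ stationary [set a : W | exists x, A x /\ has_height x a].

(** * Forcing posets ([p <= q] means that [p] is stronger than [q]) *)

Section Posets.
Context {d : Order.disp_t} {P : porderType d}.

Definition compatible (p q : P) : Prop := exists r, r <= p /\ r <= q.

Definition linked (A : set P) : Prop :=
  forall p q, A p -> A q -> compatible p q.

Definition forcing_dense (D : set P) : Prop :=
  forall p, exists q, q <= p /\ D q.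

Definition forcing_filter (G : set P) : Prop :=
  [/\ G !=set0,
      forall p q, G p -> p <= q -> G q &
      forall p q, G p -> G q -> exists r, [/\ G r, r <= p & r <= q]].

End Posets.

Definition knaster dW (W : orderType dW) d (P : porderType d) : Prop :=
  forall p : W -> P, exists X : set W, ~ countable X /\ linked (p @` X).

Definition stationarily_knaster dW (W : orderType dW) d (P : porderType d) :
    Prop :=
  forall (S : set W) (p : W -> P), stationary S ->
    exists R : set W, [/\ stationary R, R `<=` S & linked (p @` R)].

(** * The forcing relation

   A statement of the forcing language of [P] is represented by the set of
   conditions forcing it, so "p forces phi" is the application [phi p].  The
   connectives are the usual recursive clauses of the forcing relation.
   [X^] below denotes the check name of a ground model type [X].

   The subsets of [X^] in the extension are all named by sets of pairs
   [(x, p)] (where [x] stands for its check name), so quantification over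
   names of this kind is quantification over all subsets of [X^] lying in the
   extension.  Functions and sequences are treated as sets of pairs.
   Quantification over the elements of [X^] is quantification over [X]. *)

Declare Scope forcing_scope.
Delimit Scope forcing_scope with F.

Section ForcingLanguage.
Context {d : Order.disp_t} {P : porderType d}.

Definition fprop := P -> Prop.
Definition name (X : Type) := set (X * P).

(* An atomic statement about the ground model, hence absolute. *)
Definition fground (a : Prop) : fprop := fun=> a.
Definition fdensely (phi : fprop) : fprop :=
  fun p => forall q, q <= p -> exists r, r <= q /\ phi r.
Definition fnot (phi : fprop) : fprop := fun p => forall q, q <= p -> ~ phi q.
Definition fand (phi psi : fprop) : fprop := fun p => phi p /\ psi p.
Definition fimp (phi psi : fprop) : fprop :=
  fun p => forall q, q <= p -> phi q -> psi q.
Definition fall (I : Type) (phi : I -> fprop) : fprop :=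
  fun p => forall i, phi i p.
Definition fex (I : Type) (phi : I -> fprop) : fprop :=
  fdensely (fun p => exists i, phi i p).
Definition fmem (X : Type) (x : X) (tau : name X) : fprop :=
  fdensely (fun p => exists r, p <= r /\ tau (x, r)).

End ForcingLanguage.
Arguments fprop {d} P.
Arguments name {d} P X.

Notation "⌜ a ⌝" := (fground a) (format "⌜ a ⌝") : forcing_scope.
Notation "~~ phi" := (fnot phi) : forcing_scope.
Notation "phi && psi" := (fand phi psi) : forcing_scope.
Notation "phi ==> psi" := (fimp phi psi) : forcing_scope.
Notation "x \in tau" := (fmem x tau) : forcing_scope.
Notation "\all x .. y , phi" := (fall (fun x => .. (fall (fun y => phi)) ..))
  (at level 200, x binder, y binder, right associativity) : forcing_scope.
Notation "\some x .. y , phi" := (fex (fun x => .. (fex (fun y => phi)) ..))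
  (at level 200, x binder, y binder, right associativity) : forcing_scope.

Section ForcedNotions.
Context {d : Order.disp_t} {P : porderType d}.
Local Open Scope forcing_scope.

Definition check (X : Type) (A : set X) : name P X := [set xp | A xp.1].

Definition fsubset (X : Type) (A B : name P X) : fprop P :=
  \all x, (x \in A) ==> (x \in B).

(* There is an injection [f] from [A] into omega. *)
Definition fcountable (X : Type) (A : name P X) : fprop P :=
  \some f : name P (X * nat),
    (\all x, (x \in A) ==> \some n, (x, n) \in f) &&
    (\all x n m, ((x, n) \in f) && ((x, m) \in f) ==> ⌜n = m⌝) &&
    (\all x y n, ((x, n) \in f) && ((y, n) \in f) ==> ⌜x = y⌝).

Definition fwell_ordered dT (T : porderType dT) (A : name P T) : fprop P :=
  \all B : name P T, fsubset B A ==> (\some x, x \in B) ==>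
    \some m, (m \in B) && (\all y, (y \in B) ==> ⌜(m <= y)%O⌝).

(* "W^ is omega_1" *)
Definition fis_omega1 dW (W : orderType dW) : fprop P :=
  fwell_ordered (check [set: W]) &&
  ~~ fcountable (check [set: W]) &&
  (\all a : W, fcountable (check [set b : W | (b < a)%O])).

Definition fclub dW (W : orderType dW) (C : name P W) : fprop P :=
  (\all a, \some b, ⌜(a < b)%O⌝ && (b \in C)) &&
  (\all a, (\some b, ⌜(b < a)%O⌝) ==>
     (\all b, ⌜(b < a)%O⌝ ==>
        \some c, ⌜(b < c)%O⌝ && ⌜(c < a)%O⌝ && (c \in C)) ==>
     (a \in C)).

(* The isomorphism [f] between the predecessors of [x] and those of [a] is a
   relation; it is functional and injective by the last line, as the
   predecessors of [x] form a chain. *)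
Definition fhas_height dW (W : orderType dW) dT (T : porderType dT)
    (x : T) (a : W) : fprop P :=
  \some f : name P (T * W),
    (\all y b, ((y, b) \in f) ==> ⌜(y < x)%O⌝ && ⌜(b < a)%O⌝) &&
    (\all y, ⌜(y < x)%O⌝ ==> \some b, (y, b) \in f) &&
    (\all b, ⌜(b < a)%O⌝ ==> \some y, (y, b) \in f) &&
    (\all y z b c, ((y, b) \in f) && ((z, c) \in f) ==>
       ⌜(y < z)%O <-> (b < c)%O⌝).

(* The name of the subset of X^ defined by [phi] in the extension. *)
Definition fset (X : Type) (phi : X -> fprop P) : name P X :=
  [set xp | phi xp.1 xp.2].

Definition fomega1_tree dW (W : orderType dW) dT (T : porderType dT) :
    fprop P :=
  (\all x : T, fwell_ordered (check [set y : T | (y < x)%O])) &&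
  (\all x : T, \some a : W, fhas_height x a) &&
  (\all a : W, \some x : T, fhas_height x a) &&
  (\all a : W, fcountable (fset (fun x : T => fhas_height x a))).

Definition fis_chain dT (T : porderType dT) (A : name P T) : fprop P :=
  \all x y, (x \in A) && (y \in A) ==> ⌜(x >=< y)%O⌝.

Definition fis_antichain dT (T : porderType dT) (A : name P T) : fprop P :=
  \all x y, (x \in A) && (y \in A) && ~~ ⌜x = y⌝ ==> ~~ ⌜(x >=< y)%O⌝.

Definition faronszajn_tree dW (W : orderType dW) dT (T : porderType dT) :
    fprop P :=
  fomega1_tree W T && (\all A : name P T, fis_chain A ==> fcountable A).

Definition fstationary dW (W : orderType dW) (S : name P W) : fprop P :=
  \all C : name P W, fclub C ==> \some a, (a \in S) && (a \in C).

Definition fstationary_antichain dW (W : orderType dW) dT (T : porderType dT)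
    (A : name P T) : fprop P :=
  fis_antichain A &&
  fstationary (fset (fun a : W => \some x, (x \in A) && fhas_height x a)).

End ForcedNotions.

(* The conjunct [fis_omega1 W] says that W^ is the omega_1 of the extension,
   so that the remaining conjuncts, where heights are taken in W^, have their
   intended meaning there. *)
Definition tree_preserving dW (W : orderType dW) dT (T : porderType dT)
    d (P : porderType d) : Prop :=
  forall p : P,
    (fis_omega1 W && faronszajn_tree W T &&
     ~~ (\some A : name P T, fstationary_antichain W A))%F p.

(** * Properness

   Shelah's definition: for every uncountable set [X], every stationary subset
   of [X]^omega (here the set of countable subsets of X) remains stationary
   after forcing with [P]. *)

Definition countable_club (X : Type) (C : set (set X)) : Prop :=
  [/\ forall a, C a -> countable a,
      forall a, countable a -> exists b, C b /\ a `<=` b &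
      forall c : nat -> set X,
        (forall n, C (c n)) -> (forall n, c n `<=` c n.+1) ->
        C (\bigcup_n c n)].

Definition countable_stationary (X : Type) (S : set (set X)) : Prop :=
  (forall a, S a -> countable a) /\
  forall C, countable_club C -> exists a, S a /\ C a.

Section ForcedClubs.
Context {d : Order.disp_t} {P : porderType d}.
Local Open Scope forcing_scope.

(* Names for sets of subsets of X^. *)
Definition name2 (X : Type) := set (name P X * P).

(* [tau] is forced to belong to [C] when densely it is forced to be equal to
   a name listed in [C] with a condition of the generic filter. *)
Definition fmem2 (X : Type) (tau : name P X) (C : name2 X) : fprop P :=
  fdensely (fun p => exists (sigma : name P X) (r : P),
    [/\ p <= r, C (sigma, r),
        fsubset tau sigma p & fsubset sigma tau p])%O.

(* The sections of a name [c] for a sequence of subsets of X^. *)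
Definition fsection (X : Type) (c : name P (nat * X)) (n : nat) : name P X :=
  fset (fun x => (n, x) \in c).

Definition fcountable_club (X : Type) (C : name2 X) : fprop P :=
  (\all A, fmem2 A C ==> fcountable A) &&
  (\all A, fcountable A ==> \some B, fmem2 B C && fsubset A B) &&
  (\all c : name P (nat * X),
     (\all n, fmem2 (fsection c n) C) ==>
     (\all n, fsubset (fsection c n) (fsection c n.+1)) ==>
     fmem2 (fset (fun x => \some n, (n, x) \in c)) C).

(* "S^ is stationary", where [S] is a set of countable subsets of [X]. *)
Definition fcountable_stationary (X : Type) (S : set (set X)) : fprop P :=
  \all C : name2 X, fcountable_club C ==>
    \some a : set X, ⌜S a⌝ && fmem2 (check a) C.

End ForcedClubs.

Definition proper_poset d (P : porderType d) : Prop :=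
  forall (X : Type) (S : set (set X)),
    ~ countable [set: X] -> countable_stationary S ->
    forall p : P, fcountable_stationary S p.

(** * PFA(T) *)

Definition PFA_tree dW (W : orderType dW) dT (T : porderType dT) : Prop :=
  forall (d : Order.disp_t) (P : porderType d),
    [set: P] !=set0 -> proper_poset P -> tree_preserving W T P ->
    forall D : W -> set P, (forall a, forcing_dense (D a)) ->
      exists G : set P, forcing_filter G /\ forall a, G `&` D a !=set0.

(** * The poset of finite antichains, ordered by reverse inclusion *)

Record finite_antichain d (T : porderType d) := FiniteAntichain {
  antichain_set :> set T;
  antichain_finite : finite_set antichain_set;
  antichain_incomparable : is_antichain antichain_set }.

Fact finite_antichain_display : Order.disp_t.
Proof. exact: (Order.Disp tt tt). Qed.

Section FiniteAntichainPoset.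
Context d (T : porderType d).
Notation FA := (finite_antichain T).

HB.instance Definition _ := gen_eqMixin FA.
HB.instance Definition _ := gen_choiceMixin FA.

Definition finite_antichain_le (p q : FA) : bool :=
  `[< (q : set T) `<=` p >].

Lemma finite_antichain_le_refl : reflexive finite_antichain_le.
Proof. by move=> p; apply/asboolP. Qed.

Lemma finite_antichain_le_anti : antisymmetric finite_antichain_le.
Proof.
move=> [p fp ap] [q fq aq] /andP[/asboolP /= qp /asboolP /= pq].
have e : p = q by rewrite eqEsubset.
by case: _ / e fq aq {qp pq} => fq aq; congr FiniteAntichain; exact: Prop_irrelevance.
Qed.

Lemma finite_antichain_le_trans : transitive finite_antichain_le.
Proof.
by move=> q p r /asboolP qp /asboolP rq; apply/asboolP => x /rq /qp.
Qed.

HB.instance Definition _ := Order.Le_isPOrder.Build finite_antichain_display FA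
  finite_antichain_le_refl finite_antichain_le_anti finite_antichain_le_trans.

End FiniteAntichainPoset.

(* Main.v *)
(** Stationary Knasterness fails for the conditions [{x_a}] with [x_a] of height
    [a]: a linked set of these is an antichain of the tree.

    For Knasterness, a Delta-system argument reduces the claim to finite sets of
    nodes [N i] (i < omega_1) whose nodes have height at least [i]; one needs an
    uncountable [X] such that the nodes of [N i] and [N j] are incomparable for
    distinct [i], [j] in [X].  The poset adding omega many such sets with union
    unbounded in omega_1, by finite conditions, is ccc but may add a stationary
    antichain: it may select [i] too soon after some [a] for stationarily many
    [a].  Countable models are therefore used as side conditions.  A model with
    trace [a] comes with an interval starting at [a] which contains no selected
    [i] and which is longer than prescribed by any function in the model.  If
    such a condition forces a node [x] of height [a] into a name for an antichain,
    then so do conditions whose new indices [i] are arbitrarily large.  As the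
    tree has no stationary antichain, some [y < x] has the same property, and by
    Baumgartner's argument one of the conditions for [y] lying in the model is
    compatible with the given one, a contradiction. *)
Require Import Defs.
From HB Require Import structures.
From mathcomp Require Import all_boot all_order.
From mathcomp Require Import boolp classical_sets functions cardinality filter.
Set Implicit Arguments. Unset Strict Implicit. Unset Printing Implicit Defensive.
Import Order.TTheory.
Local Open Scope classical_set_scope.
Local Open Scope order_scope.

(** * Countable sets, hulls and omega_1 *)

Section Countable.

Lemma sub_countableT (T : Type) (A B : set T) :
  A `<=` B -> countable B -> countable A.
Proof. by move=> /subset_card_le; exact: sub_countable. Qed.

Lemma countable_image (T U : Type) (A : set T) (f : T -> U) :
  countable A -> countable (f @` A).
Proof. exact/sub_countable/card_image_le. Qed.

Lemma countable_preimage (T U : Type) (A : set U) (f : T -> U) :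
  injective f -> countable A -> countable (f @^-1` A).
Proof.
move=> finj /countable_injP[e einj]; apply/countable_injP.
exists (e \o f) => x y; rewrite !inE /= => Ax Ay /einj.
by rewrite !inE => /(_ Ax Ay) /finj.
Qed.

Lemma countableU (T : Type) (A B : set T) :
  countable A -> countable B -> countable (A `|` B)%classic.
Proof.
move=> cA cB; apply: (@sub_countableT _ _
  (\bigcup_(i : bool) if i then A else B)).
  by move=> x [Ax|Bx]; [exists true|exists false].
by apply: bigcup_countable => // -[].
Qed.

Lemma uncountable_nonempty (T : Type) (A : set T) :
  ~ countable A -> exists x, A x.
Proof.
move=> nA; apply: contrapT => A0; apply: nA.
by apply: sub_countableT (countable0 T) => x Ax; apply: A0; exists x.
Qed.

Lemma uncountable_bigcup (I : countType) (T : Type) (A : set T)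
    (B : I -> set T) :
  ~ countable A -> (forall x, A x -> exists i, B i x) ->
  exists i, ~ countable (A `&` B i).
Proof.
move=> nA AB; apply: contrapT => nB; apply: nA.
apply: (@sub_countableT _ _ (\bigcup_i (A `&` B i))).
  by move=> x Ax; have [i Bix] := AB _ Ax; exists i.
by apply: bigcup_countable => // i _; apply: contrapT => ?; apply: nB; exists i.
Qed.

Lemma countable_seqs (T : eqType) (A : set T) :
  countable A -> countable [set l : seq T | forall x, x \in l -> A x].
Proof.
move=> /countable_injP[f finj]; apply/countable_injP.
exists (fun l => choice.pickle (map f l)) => l1 l2.
rewrite !inE /= => A1 A2 /(pcan_inj choice.pickleK).
elim: l1 l2 A1 A2 => [|x l1 IH] [|y l2] //= A1 A2 [fxy el].
congr (_ :: _); last first.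
  by apply: IH => // z zl; [apply: A1|apply: A2]; rewrite inE zl orbT.
by apply: finj fxy; rewrite inE; [apply: A1|apply: A2]; rewrite inE eqxx.
Qed.

End Countable.

(** * Closure of sets under countably valued operations on finite lists *)

Section Hull.
Context (T : eqType) (F : seq T -> set T).

(** The sets [F l] play the role of values of Skolem functions at the finite list [l], and [hull]
    that of the Skolem hull. *)
Definition closed_under (A : set T) :=
  forall l, (forall x, x \in l -> A x) -> F l `<=` A.

Definition hull (A : set T) : set T :=
  [set x | forall B, A `<=` B -> closed_under B -> B x].

Lemma sub_hull A : A `<=` hull A.
Proof. by move=> x Ax B AB _; exact: AB. Qed.

Lemma hull_closed A : closed_under (hull A).
Proof.
move=> l lA x Flx B AB clB.
by apply: (clB l) => // y /lA; apply.
Qed.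

Lemma hull_min A B : A `<=` B -> closed_under B -> hull A `<=` B.
Proof. by move=> AB clB x; apply. Qed.

Lemma hull_sub A B : A `<=` B -> hull A `<=` hull B.
Proof.
by move=> AB; apply: hull_min (@hull_closed B) => x /AB; exact: sub_hull.
Qed.

(** A list is finite, so its members already lie in a single stage of the increasing sequence. *)
Lemma bigcup_closed_under (A : nat -> set T) :
  (forall n, A n `<=` A n.+1) ->
  (forall n l, (forall x, x \in l -> A n x) -> F l `<=` A n.+1) ->
  closed_under (\bigcup_n A n).
Proof.
move=> Ainc AF l lA.
have Ale m n : (m <= n)%N -> A m `<=` A n.
  elim: n => [|n IH]; first by rewrite leqn0 => /eqP->.
  rewrite leq_eqVlt => /orP[/eqP->//|]; rewrite ltnS => /IH mn x /mn.
  exact: Ainc.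
suff [n nl] : exists n, forall x, x \in l -> A n x.
  by move=> x Flx; exists n.+1 => //; exact: AF nl _ Flx.
elim: l lA => [|y l IH] lA; first by exists 0%N.
have [|n nl] := IH; first by move=> x xl; apply: lA; rewrite inE xl orbT.
have [|m _ my] := lA y; first by rewrite inE eqxx.
exists (maxn m n) => x; rewrite inE => /orP[/eqP->|/nl].
  by apply: Ale my; rewrite leq_maxl.
by apply: Ale; rewrite leq_maxr.
Qed.

(** This is what closes a family of countable fixed points of a hull operation under increasing
    unions. *)
Lemma hull_bigcup (A : nat -> set T) : (forall n, A n `<=` A n.+1) ->
  hull (\bigcup_n A n) = \bigcup_n hull (A n).
Proof.
move=> Ainc; rewrite eqEsubset; split; last first.
  by move=> x [n _]; apply: hull_sub => y Ay; exists n.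
apply: hull_min; first by move=> x [n _ Anx]; exists n => //; exact: sub_hull.
apply: bigcup_closed_under => [n|n l lA x Flx].
  exact: hull_sub.
by apply: (hull_sub (Ainc n)); exact: hull_closed Flx.
Qed.

(** Omega many one-step closures exhaust the hull, and a countable set has only countably many
    lists. *)
Lemma hull_countable A : (forall l, countable (F l)) -> countable A ->
  countable (hull A).
Proof.
move=> cF cA.
pose step (B : set T) : set T :=
  B `|` \bigcup_(l in [set l | forall x, x \in l -> B x]) F l.
pose B n := iter n step A.
have cB n : countable (B n).
  elim: n => [//|n IH]; apply: countableU => //.
  by apply: bigcup_countable; [exact: countable_seqs|move=> l _; exact: cF].
apply: (@sub_countableT _ _ (\bigcup_n B n)).
  apply: hull_min; first by move=> x Ax; exists 0%N.
  apply: bigcup_closed_under => [n x Bx|n l lB x Flx]; first by left.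
  by right; exists l.
by apply: bigcup_countable.
Qed.

End Hull.

(** * Bounds and clubs in omega_1 *)

Section Omega1.
Context {dW : Order.disp_t} {W : orderType dW} (W1 : is_omega1 W).

Lemma omega1_min (A : set W) a : A a ->
  exists2 m, A m & forall y, A y -> m <= y.
Proof.
by have [wo _ _] := W1 => Aa; have [||m []] := wo A => //; [exists a|exists m].
Qed.

Lemma omega1_ind (P : W -> Prop) :
  (forall a, (forall b, b < a -> P b) -> P a) -> forall a, P a.
Proof.
move=> IH a; apply: contrapT => nPa.
have [m nPm mP] := @omega1_min [set b | ~ P b] a nPa.
apply: nPm; apply: IH => b bm; apply: contrapT => /mP.
by rewrite leNgt bm.
Qed.

Lemma countable_le (a : W) : countable [set b | b <= a].
Proof.
have [_ _ cW] := W1.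
apply: sub_countableT (countableU (cW a) (countable1 a)) => b /=.
by rewrite le_eqVlt => /orP[/eqP->|ba]; [right|left].
Qed.

Lemma countable_bounded (A : set W) : countable A ->
  exists b, forall a, A a -> a < b.
Proof.
have [_ ucW _] := W1; move=> cA; apply: contrapT => nb; apply: ucW.
apply: (@sub_countableT _ _ (\bigcup_(a in A) [set b | b <= a])).
  move=> b _; apply: contrapT => nA; apply: nb; exists b => a Aa.
  by rewrite ltNge; apply/negP => ba; apply: nA; exists a.
by apply: bigcup_countable => // a _; exact: countable_le.
Qed.

Lemma omega1_gt (a : W) : exists b, a < b.
Proof.
have [b] := countable_bounded (countable1 a); move=> /(_ a erefl).
by exists b.
Qed.

Lemma uncountable_unbounded (A : set W) b : ~ countable A ->
  exists2 a, A a & b < a.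
Proof.
move=> nA; apply: contrapT => nb; apply: nA.
apply: sub_countableT (countable_le b) => a Aa /=.
by rewrite leNgt; apply/negP => ba; apply: nb; exists a.
Qed.

Lemma unbounded_uncountable (A : set W) :
  (forall b, exists2 a, A a & b <= a) -> ~ countable A.
Proof.
move=> Ab /countable_bounded[b bA]; have [a /bA ab] := Ab b.
by rewrite leNgt ab.
Qed.

Lemma bounding (I : Type) (A : W -> set I) (h : I -> W) :
  (forall a, countable (A a)) ->
  exists g : W -> W, forall a i, A a i -> h i < g a.
Proof.
move=> cA.
have /choice[g gP] a : exists b, forall i, A a i -> h i < b.
  have [b bP] := countable_bounded (countable_image h (cA a)).
  by exists b => i Aai; apply: bP; exists i.
by exists g.
Qed.

(** The function [g] picks a member of [C] above each ordinal, so its nonzero closure points are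
    limits of [C]. In this form a club can enter a model as a token [Fn g]. *)
Lemma club_closure_points (C : set W) : club C -> exists g : W -> W,
  forall d, (exists a, a < d) -> (forall a, a < d -> g a < d) -> C d.
Proof.
move=> [/choice[g gP] Ccl]; exists g => d d0 gd.
apply: Ccl => // b /gd gbd; exists (g b).
by have [bgb Cgb] := gP b; split.
Qed.

End Omega1.

(** * The forcing relation *)

Section Forcing.
Context {d : Order.disp_t} {P : porderType d}.
Implicit Types (p q r : P) (phi psi : fprop P).

Definition persistent phi := forall p q, q <= p -> phi p -> phi q.

Lemma fdensely_persistent phi : persistent (fdensely phi).
Proof. by move=> p q qp phip r rq; exact/phip/(le_trans rq). Qed.

Lemma fdensely_idem phi p : fdensely (fdensely phi) p -> fdensely phi p.
Proof.
move=> h q /h[r [rq /(_ r (lexx r))[s [sr phis]]]].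
by exists s; split=> //; exact: le_trans rq.
Qed.

Lemma fdensely_sub phi psi p : (forall q, q <= p -> phi q -> psi q) ->
  fdensely phi p -> fdensely psi p.
Proof.
move=> h phip q qp; have [r [rq phir]] := phip q qp.
by exists r; split=> //; apply: h => //; exact: le_trans qp.
Qed.

Lemma fdensely_intro phi p : persistent phi -> phi p -> fdensely phi p.
Proof. by move=> per phip q qp; exists q; split=> //; exact: per phip. Qed.

Lemma fdensely_elim phi p : fdensely phi p -> exists2 q, q <= p & phi q.
Proof. by move=> /(_ p (lexx p))[q [qp phiq]]; exists q. Qed.

Lemma fex_intro (I : Type) (phi : I -> fprop P) i p :
  persistent (phi i) -> phi i p -> fex phi p.
Proof. by move=> per phip q qp; exists q; split=> //; exists i; exact: per phip. Qed.

Lemma fex_elim (I : Type) (phi : I -> fprop P) p : fex phi p ->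
  exists2 q, q <= p & exists i, phi i q.
Proof. exact: fdensely_elim. Qed.

Lemma fmem_persistent (X : Type) (x : X) (tau : name P X) :
  persistent (fmem x tau).
Proof. exact: fdensely_persistent. Qed.

Lemma fmem_dense (X : Type) (x : X) (tau : name P X) p :
  fdensely (fmem x tau) p -> fmem x tau p.
Proof. exact: fdensely_idem. Qed.

Lemma fmem_fset (X : Type) (x : X) (phi : X -> fprop P) p :
  persistent (phi x) -> fmem x (fset phi) p <-> fdensely (phi x) p.
Proof.
move=> per; split; apply: fdensely_sub => q qp.
  by move=> [r [qr phir]]; exact: per phir.
by exists q.
Qed.

Lemma fmem_check (X : Type) (x : X) (A : set X) p :
  fmem x (check A) p <-> A x.
Proof.
split=> [/fdensely_elim[q _ [r [_ Ax]]] //|Ax q qp].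
by exists q; split=> //; exists q.
Qed.

Lemma fcountable_ground (X : Type) (A : name P X) (B : set X) p :
  (forall x q, q <= p -> fmem x A q -> B x) -> countable B -> fcountable A p.
Proof.
move=> AB /countable_injP[e einj].
have einjE x y : B x -> B y -> e x = e y -> x = y.
  by move=> Bx By; apply: einj; rewrite inE.
move=> q qp; exists q; split=> //.
exists (check [set xn : X * nat | B xn.1 /\ e xn.1 = xn.2]).
split; [split|].
- move=> x r rq xA s sr; exists s; split=> //; exists (e x).
  apply/fmem_check; split=> //=.
  exact: AB (le_trans rq qp) xA.
- by move=> x n m r rq [/fmem_check/= [_ <-] /fmem_check/= [_ <-]].
- move=> x y n r rq [/fmem_check/= [Bx ex] /fmem_check/= [By ey]].
  by apply: einjE; rewrite // ex ey.
Qed.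

(** Among all elements that some condition below [s] forces into [B], take the least; a condition
    forcing it into [B] also forces it to be the minimum of [B]. *)
Lemma fwell_ordered_ground dT (T : porderType dT) (A : set T) p :
  well_ordered A -> fwell_ordered (check A) p.
Proof.
move=> wo B q qp BA r rq Bne s sr.
have [s' s's [x xB]] := fdensely_elim (fdensely_persistent sr Bne).
pose D := [set y | exists2 t, t <= s & fmem y B t].
have DA : D `<=` A.
  move=> y [t ts yB]; apply/(@fmem_check _ _ _ t); apply: BA yB.
  by apply: le_trans ts _; exact: le_trans sr rq.
have [|m [[t ts mB] mP]] := wo D DA; first by exists x, s'.
exists t; split=> //; exists m; split=> //.
by move=> y u ut yB; apply: mP; exists u => //; exact: le_trans ts.
Qed.

Context {dW : Order.disp_t} {W : orderType dW} (W1 : is_omega1 W).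
Context {dT : Order.disp_t} {T : porderType dT}.

Lemma fhas_height_ground (x : T) (a : W) p : has_height x a -> fhas_height x a p.
Proof.
move=> [f [[fs fi fj] fo]].
apply: fdensely_intro => [q r rq [g [[[c1 c2] c3] c4]]|].
  exists g; split; [split; [split|]|].
  - by move=> y b s sr; apply: c1; exact: le_trans rq.
  - by move=> y s sr; apply: c2; exact: le_trans rq.
  - by move=> b s sr; apply: c3; exact: le_trans rq.
  - by move=> y z b c s sr; apply: c4; exact: le_trans rq.
exists (check [set yb : T * W | yb.1 < x /\ f yb.1 = yb.2]).
split; [split; [split|]|].
- by move=> y b s sp /fmem_check[/= yx <-]; split=> //; exact: fs.
- move=> y s sp yx t ts; exists t; split=> //; exists (f y).
  exact/fmem_check.
- move=> b s sp ba t ts; exists t; split=> //.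
  by have [y yx fyb] := fj _ ba; exists y; apply/fmem_check.
- move=> y z b c s sp [/fmem_check[/= yx <-] /fmem_check[/= zx <-]].
  exact: fo.
Qed.

Lemma fhas_height_abs (x : T) (a b : W) p :
  has_height x a -> fhas_height x b p -> b = a.
Proof.
move=> [f [[fs fi fj] fo]] /fex_elim[r rp [g [[[c1 c2] c3] c4]]].
(* Isomorphisms of well-orders are unique: by induction on [c], the name [g] can send the node with
   [f]-value [c] only to [c]. *)
have gf c : forall y e q, f y = c -> y < x -> q <= r -> fmem (y, e) g q ->
    e = c.
  elim/(omega1_ind W1): c => c IH y e q fyc yx qr yeg.
  have [ec|ce|//] := ltgtP e c.
    have [z zx fze] : exists2 z, z < x & f z = e.
      by apply: fj; apply: lt_trans ec _; rewrite -fyc; exact: fs.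
    have zy : z < y by apply/(fo z y zx yx); rewrite fze fyc.
    have [q' q'q [e' ze'g]] := fex_elim (c2 z q qr zx).
    have ee' : e' = e.
      exact: IH ec _ _ _ fze zx (le_trans q'q qr) ze'g.
    have := c4 z y e' e q' (le_trans q'q qr) (conj ze'g (fmem_persistent q'q yeg)).
    by rewrite ee' ltxx => -[/(_ zy)].
  have [_ eb] := c1 y e q qr yeg.
  have [q' q'q [z zcg]] := fex_elim (c3 c q qr (lt_trans ce eb)).
  have [zx _] := c1 z c q' (le_trans q'q qr) zcg.
  have zy : z < y.
    apply/(c4 z y c e q' (le_trans q'q qr)) => //.
    by split=> //; exact: fmem_persistent q'q yeg.
  have fzc : f z < c by rewrite -fyc; apply/(fo z y zx yx).
  have := IH _ fzc _ _ _ erefl zx (le_trans q'q qr) zcg.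
  by move=> fzE; rewrite -fzE ltxx in fzc.
have [ba|ab|//] := ltgtP b a.
  have [y yx fyb] := fj _ ba.
  have [q' q'q [e yeg]] := fex_elim (c2 y r (lexx r) yx).
  have [_ eb] := c1 y e q' q'q yeg.
  by move: eb; rewrite /fground (gf b y e q' fyb yx q'q yeg) ltxx.
have [q' q'q [y yag]] := fex_elim (c3 a r (lexx r) ab).
have [yx _] := c1 y a q' q'q yag.
have fya := fs y yx; have := gf _ y a q' erefl yx q'q yag.
by move=> fyE; move: fya; rewrite /= -fyE ltxx.
Qed.

End Forcing.

(** * Aronszajn trees *)

Section Tree.
Context {dW : Order.disp_t} {W : orderType dW} (W1 : is_omega1 W).
Context {dT : Order.disp_t} {T : porderType dT} (TA : aronszajn_tree W T).
Context (ht : T -> W) (htP : forall x, has_height x (ht x)).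
Implicit Types x y z : T.

Lemma ht_unique x a : has_height x a -> ht x = a.
Proof.
(* Here [W] itself serves as the forcing poset and [a] as a condition, so that uniqueness of heights
   becomes an instance of their absoluteness. *)
move=> xa; have h : fhas_height x (ht x) a by exact: fhas_height_ground.
exact: fhas_height_abs xa h.
Qed.

Lemma ht_lt y x : y < x -> ht y < ht x.
Proof.
move=> yx; have [f [[fs fi fj] fo]] := htP x.
suff -> : ht y = f y by exact: fs.
apply: ht_unique; exists f; split; last first.
  by move=> z t zy ty; apply: fo; [exact: lt_trans zy yx|exact: lt_trans ty yx].
split.
- by move=> z zy; apply/fo => //; exact: lt_trans zy yx.
- move=> z t; rewrite !inE /= => zy ty.
  by apply: fi; rewrite inE /=; [exact: lt_trans zy yx|exact: lt_trans ty yx].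
- move=> b /= bfy; have [z zx fz] : exists2 z, z < x & f z = b.
    by apply: fj; exact: lt_trans bfy (fs _ yx).
  by exists z => //=; apply/fo; rewrite // fz.
Qed.

Lemma ht_le y x : y <= x -> ht y <= ht x.
Proof. by rewrite le_eqVlt => /orP[/eqP->//|/ht_lt/ltW]. Qed.

Lemma countable_ht_lt a : countable [set x | ht x < a].
Proof.
have [[_ _ _ cT] _] := TA.
have [_ _ cW] := W1.
apply: (@sub_countableT _ _
  (\bigcup_(b in [set b | b < a]) [set x | has_height x b])).
  by move=> x xa; exists (ht x) => //; exact: htP.
by apply: bigcup_countable => // b _; exact: cT.
Qed.

Lemma countable_ht_le a : countable [set x | ht x <= a].
Proof.
have [b ab] := omega1_gt W1 a.
by apply: sub_countableT (countable_ht_lt b) => x /= xa; exact: le_lt_trans ab.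
Qed.

Lemma predecessors_comparable x y z : x <= z -> y <= z -> x >=< y.
Proof.
rewrite !le_eqVlt => /orP[/eqP->|xz] /orP[/eqP->|yz].
- exact: comparablexx.
- by rewrite comparable_sym; apply/orP; left; exact: ltW.
- by apply/orP; left; exact: ltW.
have [[wo _ _ _] _] := TA.
have [||m [xym mP]] := wo z [set x; y]; first by move=> t /= [->|->].
  by exists x; left.
case: xym => -> in mP.
  by apply/orP; left; apply: mP; right.
by apply/orP; right; apply: mP; left.
Qed.

(** The map [t] may repeat values, but the heights of its values are unbounded, so its image on [H]
    is uncountable and cannot be a chain. *)
Lemma no_unbounded_chain (H : set W) (t : W -> T) : ~ countable H ->
  (forall e, H e -> e <= ht (t e)) ->
  exists e1 e2, [/\ H e1, H e2 & ~ t e1 >=< t e2].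
Proof.
move=> nH Hht; apply: contrapT => nc.
have [_ chainT] := TA.
have /(countable_image ht)/(countable_bounded W1)[b bP] : countable (t @` H).
  apply: chainT => _ _ [e1 H1 <-] [e2 H2 <-]; apply: contrapT => ?; apply: nc.
  by exists e1, e2.
have [e He be] := uncountable_unbounded W1 b nH.
have := bP (ht (t e)) (ex_intro2 _ _ _ (ex_intro2 _ _ _ He erefl) erefl).
by rewrite ltNge (le_trans (ltW be)) // Hht.
Qed.

(* The argument of Baumgartner's theorem on finite antichains: a uniform
   ultrafilter on the bad [a] singles out one coordinate of [N e] and of [G a]
   for uncountably many [e], and these coordinates then form a chain. *)
Lemma countable_blocked (N : W -> set T) :
  (forall e, finite_set (N e)) -> (forall e t, N e t -> e <= ht t) ->
  countable [set a | exists2 G : set T, finite_set G &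
    forall e, e < a -> exists t u, [/\ N e t, G u & t <= u]].
Proof.
move=> Nfin Nht; apply: contrapT; set bad := (X in countable X) => nbad.
have toseq (A : set T) : finite_set A -> exists s : seq T, A = [set` s].
  by move/finite_seqP.
have /choice[n nP] e : exists s : seq T, N e = [set` s] by exact: toseq.
have /choice[g gP] a : exists s : seq T, bad a ->
    forall e, e < a -> exists t u, [/\ t \in n e, u \in s & t <= u].
  have [[G Gfin GP]|?] := pselect (bad a); last by exists [::].
  have [s sG] := toseq _ Gfin; exists s => _ e /GP[t [u [Nt Gu tu]]].
  by exists t, u; rewrite nP in Nt; rewrite sG in Gu.
have [|m nH] := uncountable_bigcup (B := fun m => [set a | size (g a) = m]) nbad.
  by move=> a _; exists (size (g a)).
have [_ nW _] := W1.
have [|k nK] := uncountable_bigcup (B := fun k => [set e | size (n e) = k]) nW.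
  by move=> e _; exists (size (n e)).
set H := (_ `&` _)%classic in nH; set K := (_ `&` _)%classic in nK.
have [x0 _] : exists x0 : T, True.
  have [e _] := uncountable_nonempty nW.
  by have [[_ _ /(_ e)[x _] _] _] := TA; exists x.
(* An ultrafilter extending this filter contains every set that misses only countably many members
   of [H], in particular the final segments of [H]. *)
pose F : set_system W := [set B | countable (H `\` B)].
have FF : ProperFilter F.
  split; first by rewrite /F /= setD0.
  split; first by rewrite /F /= setDT.
    move=> A B /= FA FB; rewrite /F /= setDIr.
    exact: countableU.
  by move=> A B AB; apply: sub_countableT => x [Hx nBx]; split=> // /AB.
have [U [UU FU]] := ultraFilterLemma FF.
have UP e : K e -> exists ij : 'I_k * 'I_m,
    U [set a | H a /\ nth x0 (n e) ij.1 <= nth x0 (g a) ij.2].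
  move=> [_ ke]; apply: contrapT => nU.
  (* If no pair of coordinates were large, the complements of the finitely many sets would meet in a
     large set; but any member of [H] above [e] belongs to one of these sets. *)
  have Us (s : seq ('I_k * 'I_m)) : U [set a | forall ij, ij \in s ->
      ~ (H a /\ nth x0 (n e) ij.1 <= nth x0 (g a) ij.2)].
    elim: s => [|ij s IH]; first by apply: filterS (@filterT _ U _).
    have Uij : U (~` [set a | H a /\ nth x0 (n e) ij.1 <= nth x0 (g a) ij.2]).
      have [UA|//] := in_ultra_setVsetC
        [set a | H a /\ nth x0 (n e) ij.1 <= nth x0 (g a) ij.2] UU.
      by case: nU; exists ij.
    apply: filterS (filterI Uij IH) => a [aij ajs] ij'.
    by rewrite inE => /orP[/eqP->//|]; exact: ajs.
  have UH : U [set a | H a /\ e < a].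
    apply: FU; apply: sub_countableT (countable_le W1 e) => a [Ha nHa] /=.
    by rewrite leNgt; apply/negP => ea; apply: nHa.
  have [a [[Ha ea] aP]] := filter_ex (filterI UH (Us (enum predT))).
  have [[bada ga] [t [u [tn ug tu]]]] : H a /\ exists t u,
      [/\ t \in n e, u \in g a & t <= u].
    by split=> //; apply: gP ea; case: Ha.
  have ti : (index t (n e) < k)%N by rewrite -[X in (_ < X)%N]ke index_mem.
  have ui : (index u (g a) < m)%N by rewrite -[X in (_ < X)%N]ga index_mem.
  apply: (aP (Ordinal ti, Ordinal ui)); first by rewrite mem_enum.
  by split; rewrite //= !nth_index.
have [ij nKij] := uncountable_bigcup nK UP.
have [|e1 [e2 [K1 K2]]] := no_unbounded_chain
    (t := fun e => nth x0 (n e) ij.1) nKij.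
  move=> e [[_ ke] _]; apply: Nht; rewrite nP /= mem_nth //.
  by rewrite ke.
(* Two large sets meet, and an [a] in both puts the two coordinates below the same node of [g a]. *)
case; have [[_ U1] [_ U2]] := (K1, K2).
have [a [[_ h1] [_ h2]]] := filter_ex (filterI U1 U2).
exact: predecessors_comparable h1 h2.
Qed.

(** The minimal nodes of [Y] form an antichain. It is not stationary, so some club avoids the
    heights of its nodes. *)
Lemma reflecting_club (Y : set T) :
  ~ (exists A : set T, stationary_antichain W A) ->
  exists2 C : set W, club C &
    forall x, Y x -> C (ht x) -> exists2 y, y < x & Y y.
Proof.
move=> nA; pose A := [set x | Y x /\ ~ exists2 y, y < x & Y y].
have antiA : is_antichain A.
  move=> x y [Yx nx] [Yy ny] xy /orP[|]; rewrite le_eqVlt => /orP[/eqP|].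
  - by [].
  - by move=> lxy; apply: ny; exists x.
  - by move=> yx; apply: xy.
  - by move=> lyx; apply: nx; exists y.
apply: contrapT => nC; apply: nA; exists A; split=> // C clC.
apply: contrapT => nS; apply: nC; exists C => // x Yx Cx.
apply: contrapT => nx; apply: nS; exists (ht x); split=> //.
by exists x; split.
Qed.

End Tree.

(** * The forcing poset *)

(* [Md a b M] stands for a countable elementary submodel: [M] enumerates its
   elements, [a] is its trace on omega_1, and [Pr i n] is excluded whenever
   [a <= i <= b].  [Gap a b] excludes models with trace in the half-open interval
   (a, b]; this makes the generic set of traces closed.  [Pr i n] puts [i] into
   the [n]-th homogeneous set.  [Fn h] occurs only as an element of models and
   makes their intervals long: [h a <= b]. *)
Inductive token (W : Type) :=
| Fn of (W -> W)
| Md of W & W & (nat -> token W)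
| Gap of W & W
| Pr of W & nat.

HB.instance Definition _ W := gen_eqMixin (token W).
HB.instance Definition _ W := gen_choiceMixin (token W).

Fact condition_display : Order.disp_t.
Proof. exact: (Order.Disp tt tt). Qed.

Section Conditions.
Context {dW : Order.disp_t} {W : orderType dW}.
Context {dT : Order.disp_t} {T : porderType dT}.
Context (N : W -> seq T).
Notation token := (token W).
Implicit Types (t u : token) (a b i j : W) (M : nat -> token).

Definition valid t : Prop :=
  match t with
  | Fn _ => False
  | Md a b M => a <= b /\ forall h, range M (Fn h) -> h a <= b
  | _ => True
  end.

(** Inclusion is required along with membership, as it holds for countable elements of an elementary
    submodel. *)
Definition inside M t : Prop :=
  range M t /\ forall a b M', t = Md a b M' -> range M' `<=` range M.

(** Tokens of different kinds are compared in one order only, because [tokens_coherent] quantifies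
    over both orders. *)
Definition coherent t u : Prop :=
  match t, u with
  | Md a b M, Md a' b' M' =>
      [\/ t = u, b < a' /\ inside M' t | b' < a /\ inside M u]
  | Md a b M, Gap c e => ~ (c < a <= e)
  | Md a b M, Pr i n => ~ (a <= i <= b)
  | Pr i n, Pr j m =>
      n = m -> i <> j -> forall x y, x \in N i -> y \in N j -> ~ x >=< y
  | _, _ => True
  end.

Record condition := Condition {
  tokens :> token -> Prop;
  tokens_finite : finite_set (tokens : set token);
  tokens_valid : forall t, tokens t -> valid t;
  tokens_coherent : forall t u, tokens t -> tokens u -> coherent t u }.

Lemma condition_inj (p q : condition) : tokens p = tokens q -> p = q.
Proof.
case: p q => [p pf pv pc] [q qf qv qc] /= e; case: _ / e in qf qv qc *.
by congr Condition; exact: Prop_irrelevance.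
Qed.

HB.instance Definition _ := gen_eqMixin condition.
HB.instance Definition _ := gen_choiceMixin condition.

Definition condition_le (p q : condition) : bool :=
  `[< tokens q `<=` tokens p >].

Lemma condition_le_refl : reflexive condition_le.
Proof. by move=> p; apply/asboolP. Qed.

Lemma condition_le_anti : antisymmetric condition_le.
Proof.
move=> p q /andP[/asboolP qp /asboolP pq].
by apply: condition_inj; rewrite eqEsubset.
Qed.

Lemma condition_le_trans : transitive condition_le.
Proof.
by move=> q p r /asboolP qp /asboolP rq; apply/asboolP => x /rq /qp.
Qed.

HB.instance Definition _ := Order.Le_isPOrder.Build condition_display condition
  condition_le_refl condition_le_anti condition_le_trans.

Implicit Types p q r s : condition.

Lemma condition_leP p q : reflect (tokens q `<=` tokens p) (p <= q).
Proof. exact: asboolP. Qed.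

Lemma empty_subproof : [/\ finite_set (set0 : set token),
  forall t, set0 t -> valid t &
  forall t u, (set0 : set token) t -> (set0 : set token) u -> coherent t u].
Proof. by split. Qed.

Definition empty_condition : condition :=
  let: And3 f v c := empty_subproof in Condition f v c.

Lemma union_condition p (A : set token) : finite_set A ->
  (forall t, A t -> valid t) ->
  (forall t u, A t -> A u -> coherent t u) ->
  (forall t u, A t -> p u -> coherent t u /\ coherent u t) ->
  exists2 q, q <= p & tokens q = (tokens p `|` A)%classic.
Proof.
move=> fA vA cA cAp.
have f : finite_set (tokens p `|` A)%classic.
  by rewrite finite_setU; split=> //; exact: tokens_finite.
have v t : (tokens p `|` A)%classic t -> valid t.
  by case; [exact: tokens_valid|exact: vA].
have c t u : (tokens p `|` A)%classic t -> (tokens p `|` A)%classic u ->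
    coherent t u.
  move=> [pt|At] [pu|Au]; first exact: tokens_coherent pt pu.
  - by have [] := cAp u t Au pt.
  - by have [] := cAp t u At pu.
  - exact: cA.
by exists (Condition f v c) => //; apply/condition_leP => t; left.
Qed.

Lemma add_token p t : valid t -> coherent t t ->
  (forall u, p u -> coherent t u /\ coherent u t) ->
  exists2 q, q <= p & tokens q = (tokens p `|` [set t])%classic.
Proof.
move=> vt ct cp; apply: union_condition; first exact: finite_set1.
- by move=> _ ->.
- by move=> _ _ -> ->.
- by move=> _ u ->; exact: cp.
Qed.

Lemma model_coherent p a b M a' b' M' : p (Md a b M) -> p (Md a' b' M') ->
  [\/ Md a b M = Md a' b' M', b < a' /\ inside M' (Md a b M) |
    b' < a /\ inside M (Md a' b' M')].
Proof. by move=> p1 p2; have := tokens_coherent p1 p2. Qed.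

Lemma model_le p a b M : p (Md a b M) -> a <= b.
Proof. by move=> /tokens_valid[]. Qed.

Lemma model_bound p a b M h : p (Md a b M) -> range M (Fn h) -> h a <= b.
Proof. by move=> /tokens_valid[_]; apply. Qed.

Lemma model_gap p a b M c e : p (Md a b M) -> p (Gap c e) -> ~ (c < a <= e).
Proof. by move=> p1 p2; have := tokens_coherent p1 p2. Qed.

Lemma model_pair p a b M i n : p (Md a b M) -> p (Pr i n) -> ~ (a <= i <= b).
Proof. by move=> p1 p2; have := tokens_coherent p1 p2. Qed.

Lemma pair_pair p i j n : p (Pr i n) -> p (Pr j n) -> i <> j ->
  forall x y, x \in N i -> y \in N j -> ~ x >=< y.
Proof. by move=> p1 p2; have := tokens_coherent p1 p2; apply. Qed.

(** Meant for a condition with a model of trace [a]: the small tokens are those which that model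
    sees. *)
Definition small a t : Prop :=
  match t with
  | Fn _ => False
  | Md c e _ => e < a
  | Gap c e => c < a /\ e < a
  | Pr i _ => i < a
  end.

Lemma add_model p a b M : a <= b -> (forall h, range M (Fn h) -> h a <= b) ->
  (forall t, p t -> small a t /\ inside M t) ->
  exists2 q, q <= p & tokens q = (tokens p `|` [set Md a b M])%classic.
Proof.
move=> ab hM pM; apply: add_token => //; first by apply: Or31.
move=> u pu; have [] := pM u pu; case: u pu => [h|a' b' M'|c e|i n] pu /=.
- by [].
- move=> b'a iM; split; first by apply: Or33.
  by apply: Or32.
- by move=> [_ ea] _; split=> //; rewrite leNgt ea andbF.
- by move=> ia _; split=> //; rewrite leNgt ia.
Qed.

Lemma model_lt p a b M a' b' M' : p (Md a b M) -> p (Md a' b' M') -> a < a' ->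
  b < a' /\ inside M' (Md a b M).
Proof.
move=> pM pM' aa'; have [[e _ _]|[//]|[b'a _]] := model_coherent pM pM'.
  by rewrite e ltxx in aa'.
by have := lt_trans b'a aa'; rewrite ltNge (model_le pM').
Qed.

Lemma restrict_condition p (A : set token) :
  exists2 q, p <= q & tokens q = [set t | p t /\ A t].
Proof.
pose B := [set t | p t /\ A t].
have f : finite_set B by apply: sub_finite_set (tokens_finite p) => t [].
have v t : B t -> valid t by move=> [/tokens_valid].
have c t u : B t -> B u -> coherent t u.
  by move=> [pt _] [pu _]; exact: tokens_coherent pt pu.
by exists (Condition f v c) => //; apply/condition_leP => t [].
Qed.

Lemma pair_large p a b M i n : p (Md a b M) -> p (Pr i n) ->
  ~ small a (Pr i n) -> b < i.
Proof.
move=> pM pi /= /negP; rewrite -leNgt => ai.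
by rewrite ltNge; apply/negP => ib; case: (model_pair pM pi); rewrite ai ib.
Qed.

Context (ht : T -> W) (ht_le : forall x y : T, x <= y -> ht x <= ht y).
Context (htN : forall i x, x \in N i -> i <= ht x).

Lemma amalgamate r s a b M : r (Md a b M) ->
  (forall t, r t -> small a t -> s t) ->
  (forall t, s t -> small a t) ->
  (forall c e M', s (Md c e M') -> inside M (Md c e M')) ->
  (forall i n x, s (Pr i n) -> x \in N i -> ht x < a) ->
  (forall i n x j m y, s (Pr i n) -> ~ r (Pr i n) -> x \in N i ->
     r (Pr j m) -> a <= j -> y \in N j -> ~ x <= y) ->
  compatible r s.
Proof.
move=> rM rs sa sM shs snode.
suff cross t u : s t -> r u -> coherent t u /\ coherent u t.
  have [q qr qE] := union_condition (tokens_finite s) (@tokens_valid s)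
    (@tokens_coherent s) cross.
  exists q; split=> //.
  by apply/condition_leP => t st; rewrite qE; right.
move=> st ru; have [us|nus] := pselect (small a u).
  have su := rs _ ru us.
  by split; [exact: tokens_coherent st su|exact: tokens_coherent su st].
case: u ru nus => [h|a2 b2 M2|c e|j m] ru nus.
- by have := tokens_valid ru.
- have [aa2 MM2] : a <= a2 /\ range M `<=` range M2.
    have [[<- _ <-]|[ba2 [rMM2 MM2]]|[b2a _]] := model_coherent rM ru.
    + by split.
    + split; last exact: MM2.
      by apply: le_trans (ltW ba2); exact: model_le rM.
    + by case: nus.
  case: t st => [h|a1 b1 M1|c e|i n] st /=.
  + by have := tokens_valid st.
  + have b1a2 : b1 < a2 by apply: lt_le_trans aa2; exact: sa st.
    have iM : inside M2 (Md a1 b1 M1).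
      have [M1M M1sub] := sM _ _ _ st; split; first exact: MM2.
      by move=> ? ? ? [_ _ <-]; apply: subset_trans MM2; exact: M1sub.
    by split; [apply: Or32|apply: Or33].
  + have [_ ea] := sa _ st.
    by split=> //; rewrite leNgt (lt_le_trans ea) // andbF.
  + by have ia := sa _ st; split=> //; rewrite leNgt (lt_le_trans ia).
(* A gap of [r] across [a] would exclude the model with trace [a]; hence a gap that is not small
   starts at or above [a]. *)
- case: t st => [h|a1 b1 M1|c1 e1|i n] st //=.
  split=> //; apply/negP; rewrite negb_and -leNgt; apply/orP; left.
  have b1a := sa _ st; have a1b1 := model_le st.
  apply: le_trans a1b1 _; apply: le_trans (ltW b1a) _.
  rewrite leNgt; apply/negP => ca; apply: nus; split=> //.
  rewrite ltNge; apply/negP => ae.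
  by apply: (model_gap rM ru); rewrite ca ae.
- have bj := pair_large rM ru nus.
  have aj : a <= j by move: nus => /= /negP; rewrite -leNgt.
  case: t st => [h|a1 b1 M1|c1 e1|i n] st //=.
    have b1a := sa _ st; split=> //.
    by rewrite [j <= b1]leNgt (lt_le_trans b1a aj) andbF.
  suff h : n = m -> i <> j -> forall x y, x \in N i -> y \in N j -> ~ x >=< y.
    split=> // nm ij x y xi yj; rewrite comparable_sym.
    by apply: h => // ji; apply: ij.
  move=> nm ij x y xi yj.
  have [ri|nri] := pselect (r (Pr i n)).
    by move: ru; rewrite -nm => ru; exact: pair_pair ri ru ij _ _ xi yj.
  case/orP => [|/ht_le]; first exact: snode st nri xi ru aj yj.
  by rewrite leNgt (lt_le_trans (shs _ _ _ st xi)) // (le_trans aj) // htN.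
Qed.

End Conditions.

Lemma countable_range (X : Type) (S : set X) x0 :
  countable S -> S x0 -> exists f : nat -> X, range f = S.
Proof.
move=> /countable_injP[e einj] Sx0.
have /choice[f fP] n : exists x, S x /\ forall y, S y -> e y = n -> y = x.
  have [[x [Sx <-]]|nx] := pselect (exists x, S x /\ e x = n).
    by exists x; split=> // y Sy; apply: einj; rewrite inE.
  by exists x0; split=> // y Sy ey; case: nx; exists y.
exists f; rewrite eqEsubset; split=> [_ [n _ <-]|x Sx].
  by have [] := fP n.
by exists (e x) => //; apply/esym; have [_] := fP (e x); apply.
Qed.

(** * Countable models and amalgamation over them *)

Section Models.
Context {dW : Order.disp_t} {W : orderType dW} (W1 : is_omega1 W).
Context {dT : Order.disp_t} {T : porderType dT} (TA : aronszajn_tree W T).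
Context (ht : T -> W) (htP : forall x, has_height x (ht x)).
Context (N : W -> seq T) (htN : forall i x, x \in N i -> i <= ht x).
Notation token := (token W).
Notation condition := (condition N).
Notation ord a := (Gap a a).
Implicit Types (t u : token) (a b c e i j : W) (M : nat -> token).
Implicit Types (p q r s : condition) (S : set token).

(** The token [Gap a a], written [ord a], codes the ordinal [a]. The clauses make the coded ordinals
    an initial segment and provide the closure that [model] demands. *)
Definition token_closure (l : seq token) : set token :=
  match l with
  | [:: Gap c e] =>
      [set Gap b.1 b.2 | b in [set b | b <= c] `*` [set b | b <= c]] `|`
      [set Pr b.1 b.2 | b in [set b | b <= c] `*` [set: nat]] `|`
      [set ord e]
  | [:: Pr i n] => ord i |` [set ord (ht x) | x in [set` N i]]
  | [:: Md c e M] => ord e |` range M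
  | [:: Fn h; Gap c e] => [set ord (h c)]
  | _ => set0
  end.

Lemma token_closure_countable l : countable (token_closure l).
Proof.
case: l => [|[h|c e M|c e|i n] [|[h'|c' e' M'|c' e'|i' n'] [|? ?]]] //=.
- by apply: countableU; [exact: countable1|exact: countable_image].
- apply: countableU; last exact: countable1.
  apply: countableU; apply: countable_image; apply: countableX => //.
  + exact: countable_le.
  + exact: countable_le.
  + exact: countable_le.
- apply: countableU; first exact: countable1.
  exact/countable_image/finite_set_countable/finite_seq.
Qed.

(** These closure properties are the part of elementarity that amalgamation uses; [a] is the trace
    of [S] on omega_1. *)
Record model (S : set token) (a : W) : Prop := Model {
  model_gap_in : forall c e, c < a -> e < a -> S (Gap c e);
  model_pair_in : forall i n, i < a -> S (Pr i n);
  model_small : forall t, S t -> small a t \/ exists h, t = Fn h;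
  model_trans : forall c e M, S (Md c e M) -> range M `<=` S;
  model_node : forall i n x, S (Pr i n) -> x \in N i -> ht x < a;
  model_fun : forall h b, S (Fn h) -> b < a -> h b < a }.

Lemma small_in_model r a b M t : r (Md a b M) -> model (range M) a ->
  r t -> small a t -> range M t.
Proof.
move=> rM mM; case: t => [h|c e M'|c e|i m] rt //=.
- move=> ea; have ca : c < a by apply: le_lt_trans ea; exact: model_le rt.
  by have [_ []] := model_lt rt rM ca.
- by move=> [ca ea]; exact: model_gap_in mM _ _ ca ea.
- by move=> ia; exact: model_pair_in mM _ _ ia.
Qed.

(** The trace is the least ordinal whose code is missing from [S]; since coded ordinals are closed
    downwards, all of them lie below it. *)
Lemma closed_model S : closed_under token_closure S -> countable S ->
  exists a, model S a.
Proof.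
move=> clS cS.
have cl1 t u : S t -> token_closure [:: t] u -> S u.
  by move=> St; apply: clS => x; rewrite inE => /eqP->.
have cO : countable [set a | S (ord a)].
  move: cS => /countable_injP[f finj]; apply/countable_injP.
  exists (fun a => f (ord a)) => a b; rewrite !inE /= => Sa Sb /finj.
  by rewrite !inE => /(_ Sa Sb) [].
have [a0 a0P] := countable_bounded W1 cO.
have [|a nSa aP] := @omega1_min _ _ W1 [set a | ~ S (ord a)] a0.
  by move=> /a0P; rewrite ltxx.
have below b : b < a -> S (ord b).
  by move=> ba; apply: contrapT => /aP; rewrite leNgt ba.
have belowN b e : S (Gap b e) -> b < a.
  move=> Sb; rewrite ltNge; apply/negP => ab; apply: nSa; apply: cl1 Sb _.
  by left; left; exists (a, a) => //; split=> /=.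
exists a; split.
- move=> c e ca ea; have [ce|ec] := leP c e.
    by apply: cl1 (below _ ea) _; left; left; exists (c, e) => //; split=> /=.
  apply: cl1 (below _ ca) _; left; left; exists (c, e) => //.
  by split=> //=; exact: ltW.
- move=> i n ia; apply: cl1 (below _ ia) _; left; right; exists (i, n) => //.
  by split=> /=.
- move=> [h|c e M|c e|i n] St.
  + by right; exists h.
  + by left; apply: (belowN e e); apply: cl1 St _; left.
  + left; split; first exact: belowN St.
    by apply: (belowN e e); apply: cl1 St _; right.
  + by left; apply: (belowN i i); apply: cl1 St _; left.
- by move=> c e M SM t Mt; apply: cl1 SM _; right.
- move=> i n x Si xi; apply: (belowN _ (ht x)).
  by apply: cl1 Si _; right; exists x.
- move=> h b Sh /below Sb; apply: (belowN _ (h b)).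
  apply: (clS [:: Fn h; ord b]) => // x.
  by rewrite !inE => /orP[]/eqP->.
Qed.

(** Only countably many [Fn h] lie in [S], so their values at the trace have a bound, which becomes
    the end of the interval. The member [t0] makes [S] nonempty and thus the range of a sequence. *)
Lemma closed_token S t0 : closed_under token_closure S -> countable S -> S t0 ->
  exists a b M, [/\ range M = S, model S a & valid (Md a b M)].
Proof.
move=> clS cS St0; have [a mS] := closed_model clS cS.
have [M rM] := countable_range cS St0.
have [b bP] : exists b, forall c,
    (c = a \/ exists2 h, S (Fn h) & c = h a) -> c < b.
  apply: (countable_bounded W1).
  apply: (@sub_countableT _ _
    (a |` [set (if M n is Fn h then h a else a) | n in [set: nat]])%classic).
    move=> c [->|[h Sh ->]]; first by left.
    by move: Sh; rewrite -rM => -[n _ Mn]; right; exists n => //; rewrite Mn.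
  by apply: countableU; [exact: countable1|exact: countable_image].
exists a, b, M; split=> //; split; first by apply/ltW/bP; left.
by move=> h; rewrite rM => Sh; apply/ltW/bP; right; exists h.
Qed.

Lemma add_closed_token p S a b M :
  range M = S -> model S a -> valid (Md a b M) ->
  tokens p `<=` S ->
  exists2 q, q <= p & tokens q = (tokens p `|` [set Md a b M])%classic.
Proof.
move=> rM mS [ab hM] pS; apply: add_model => // t pt; have St := pS _ pt; split.
  by have [//|[h th]] := model_small mS St; have := tokens_valid pt; rewrite th.
split; first by rewrite rM.
move=> c e M' tE; rewrite rM; apply: (model_trans mS (c := c) (e := e)).
by rewrite -tE.
Qed.

(** The condition [s] comes from a model [S] contained in [M], possibly with a smaller trace; being
    a model supplies the bounds on tokens and nodes that [amalgamate] asks for. *)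
Lemma amalgamate_model r s a b M S a' : r (Md a b M) -> model S a' -> a' <= a ->
  S `<=` range M -> tokens s `<=` S -> (forall t, r t -> small a t -> s t) ->
  (forall i n x j m y, s (Pr i n) -> ~ r (Pr i n) -> x \in N i ->
     r (Pr j m) -> a <= j -> y \in N j -> ~ x <= y) ->
  compatible r s.
Proof.
move=> rM mS a'a SM sS rs; apply: (amalgamate (ht_le W1 htP) htN rM rs).
- move=> t st; have [|[h th]] := model_small mS (sS _ st); last first.
    by have := tokens_valid st; rewrite th.
  case: t {st} => [h|c e M'|c e|i n] //=.
  + by move=> ea'; exact: lt_le_trans a'a.
  + by move=> [ca ea]; split; exact: lt_le_trans a'a.
  + by move=> ia; exact: lt_le_trans a'a.
- move=> c e M' /sS SM'; split; first exact: SM.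
  move=> ? ? ? [_ _ <-]; apply: subset_trans SM.
  exact: model_trans mS _ _ _ SM'.
- move=> i n x /sS Si xi; apply: lt_le_trans a'a.
  exact: model_node mS _ _ _ Si xi.
Qed.

(** [countable_blocked] is applied to the nodes of [g e] together with those of the new pairs of
    [s e], new meaning outside [u0]. The exceptional [a] form a countable set, bounded by [b]. *)
Lemma unblocked (u0 : set token) (s : W -> condition) (g : W -> seq T) :
  (forall e i n, s e (Pr i n) -> ~ u0 (Pr i n) -> e <= i) ->
  (forall e x, x \in g e -> e <= ht x) ->
  exists b, forall a, b <= a -> forall G : set T, finite_set G ->
    exists2 e, e < a & forall y, G y ->
      (forall x, x \in g e -> ~ x <= y) /\
      forall i n x, s e (Pr i n) -> ~ u0 (Pr i n) -> x \in N i -> ~ x <= y.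
Proof.
move=> se ge.
pose B e : set T := [set` g e] `|`
  \bigcup_(t in tokens (s e)) (if t is Pr i n then
    [set x | x \in N i /\ ~ u0 (Pr i n)] else set0).
have finB e : finite_set (B e).
  rewrite /B finite_setU; split; first exact: finite_seq.
  apply: bigcup_finite; first exact: tokens_finite.
  move=> [h|c e' M|c e'|i n] _ //.
  by apply: sub_finite_set (finite_seq (N i)) => x [].
have [|b bP] := countable_bounded W1 (countable_blocked W1 TA (ht := ht) finB _).
  move=> e t [/ge//|[[h|c e' M|c e'|i n] st //= [xi nu]]].
  by apply: le_trans (htN xi); exact: se st nu.
exists b => a ba G finG; apply: contrapT => nG.
have := bP a; rewrite ltNge ba => /(_ _)/negP; apply=> //.
exists G => // e ea; apply: contrapT => ne; apply: nG; exists e => // y Gy.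
split=> [x xg xy|i n x si nu xi xy]; apply: ne; exists x, y; split=> //.
  by left.
by right; exists (Pr i n).
Qed.

End Models.

(** * Generic conditions *)

Section Generic.
Context {dW : Order.disp_t} {W : orderType dW} (W1 : is_omega1 W).
Context {dT : Order.disp_t} {T : porderType dT} (TA : aronszajn_tree W T).
Context (ht : T -> W) (htP : forall x, has_height x (ht x)).
Context (N : W -> seq T) (htN : forall i x, x \in N i -> i <= ht x).
Notation token := (token W).
Notation condition := (condition N).
Notation ord a := (Gap a a).
Implicit Types (t u : token) (a b c e i j : W) (M : nat -> token).
Implicit Types (p q r s : condition).

Lemma finite_nodes r : finite_set [set x | exists j m, r (Pr j m) /\ x \in N j].
Proof.
apply: (@sub_finite_set _ _ (\bigcup_(t in tokens r)
    (if t is Pr j m then [set` N j] else set0))).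
  by move=> x [j [m [rj xj]]]; exists (Pr j m).
apply: bigcup_finite; first exact: tokens_finite.
by move=> [h|c e M|c e|i n] _ //; exact: finite_seq.
Qed.

(** A substitute for elementarity of [K]. If for every [e] some triple satisfies [D] over [L] with
    new pairs and nodes beyond [e], one triple per [e] is fixed and put into [E e], and [unblocked]
    finds an [e < a] whose triple avoids [G]. If this fails at some [e0], then [e0] is put into [K],
    and the triple given by [r] contradicts the failure. *)
Lemma reflection (X : eqType) (D : condition -> X -> seq T -> Prop)
    (L : seq token) :
  exists E : W -> set (X + token), (forall e, countable (E e)) /\
  forall (K : set (X + token)) a, model ht N (inr @^-1` K) a ->
    (exists c, c < a) -> (forall e, e < a -> E e `<=` K) ->
  forall r x g, D r x g -> [set` L] `<=` tokens r ->
    (forall i m, r (Pr i m) -> Pr i m \notin L -> a <= i) ->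
    (forall z, z \in g -> a <= ht z) ->
  forall G : set T, finite_set G -> exists s x' g',
    [/\ D s x' g', [set` L] `<=` tokens s, tokens s `<=` inr @^-1` K,
      K (inl x') & (forall z, z \in g' -> ht z < a) /\
      forall y, G y -> (forall z, z \in g' -> ~ z <= y) /\
      forall i m z, s (Pr i m) -> Pr i m \notin L -> z \in N i -> ~ z <= y].
Proof.
pose ok e (o : condition * X * seq T) := [/\ D o.1.1 o.1.2 o.2,
  [set` L] `<=` tokens o.1.1,
  forall i m, o.1.1 (Pr i m) -> Pr i m \notin L -> e <= i &
  forall z, z \in o.2 -> e <= ht z].
have [large|small] := pselect (forall e, exists o, ok e o); last first.
  (* The bound [e0] on the new pairs is in [K], but those of [r] lie above [a]. *)
  have [e0 ne0] : exists e0, ~ exists o, ok e0 o.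
    apply: contrapT => h; apply: small => e; apply: contrapT => ?.
    by apply: h; exists e.
  exists (fun=> [set inr (ord e0)]); split; first by move=> e; exact: countable1.
  move=> K a mK [c ca] /(_ _ ca) EK r x g Drxg Lr ar ag.
  have e0a : e0 < a.
    by have [[//]|[]] := model_small mK (EK _ erefl : (inr @^-1` K) (ord e0)).
  case: ne0; exists (r, x, g); split=> //=.
    by move=> i m ri Li; apply: le_trans (ltW e0a) _; exact: ar ri Li.
  by move=> z zg; apply: le_trans (ltW e0a) _; exact: ag.
have /choice[o oP] := large.
have [||b bP] := @unblocked _ _ W1 _ _ TA ht N htN [set` L]
    (fun e => (o e).1.1) (fun e => (o e).2).
- by move=> e i n oi /negP; have [_ _ h _] := oP e; exact: h.
- by move=> e x; have [_ _ _] := oP e; apply.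
exists (fun e => inr @` tokens (o e).1.1 `|` [set inl (o e).1.2; inr (ord b)] `|`
    (fun z => inr (ord (ht z))) @` [set` (o e).2]); split.
  move=> e; apply: countableU; last first.
    exact/countable_image/finite_set_countable/finite_seq.
  apply: countableU; last exact/finite_set_countable/finite_set2.
  exact/countable_image/finite_set_countable/tokens_finite.
move=> K a mK [c ca] EK r x g Drxg Lr ar ag G finG.
have ba : b < a.
  have Kb : (inr @^-1` K) (ord b) by apply: (EK _ ca); left; right; right.
  by have [[//]|[]] := model_small mK Kb.
have [e ea eP] := bP a (ltW ba) G finG.
have [De Le _ _] := oP e.
exists (o e).1.1, (o e).1.2, (o e).2; split=> //.
- by move=> t ot; apply: (EK e ea); left; left; exists t.
- by apply: (EK e ea); left; right; left.
split=> [z zo|y Gy].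
  have Kz : (inr @^-1` K) (ord (ht z)) by apply: (EK _ ea); right; exists z.
  by have [[//]|[]] := model_small mK Kz.
have [h1 h2] := eP y Gy; split=> // i m z si Li zi.
by apply: h2 si _ zi; exact/negP.
Qed.

(** A form of genericity over a countable model with trace [A] on [X]: whatever an extension [r] of
    [q] satisfies is also satisfied, with a witness in [A], by a condition compatible with [r]. The
    lists [g] and [g'] carry nodes to be made incomparable, and [l] and [n] are parameters. *)
Lemma generic_condition (X : eqType) (x0 : X)
    (D : seq X -> nat -> condition -> X -> seq T -> Prop) p :
  exists2 C : set (set X), countable_club C & forall A, C A -> A x0 /\
    exists a q, q <= p /\ forall l n r x g, (forall y, y \in l -> A y) ->
      r <= q -> D l n r x g -> (forall z, z \in g -> a <= ht z) ->
    exists s x' g', [/\ A x', D l n s x' g', compatible r s &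
      forall z z', z \in g -> z' \in g' -> ~ z >=< z'].
Proof.
have /choice[E EP] (k : seq X * nat * seq token) :=
  reflection (D k.1.1 k.1.2) k.2.
have [_ nW _] := W1; have [w0 _] := uncountable_nonempty nW.
pose lefts (l : seq (X + token)) :=
  pmap (fun o => if o is inl x then Some x else None) l.
pose rights (l : seq (X + token)) :=
  pmap (fun o => if o is inr t then Some t else None) l.
have leftsE l L : lefts (map inl l ++ map inr L) = l.
  rewrite /lefts pmap_cat; elim: l => [|x l IH] /=; last by rewrite IH.
  by elim: L.
have rightsE l L : rights (map inl l ++ map inr L) = L.
  rewrite /rights pmap_cat; elim: l => [|x l IH] //=.
  by elim: L => [//|t L IH] /=; congr (_ :: _).
(* A leading token [Gap e _] supplies the argument [e] of [E]; the rest of the list supplies the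
   parameters from [X] and the root [L]. Taking all [n] at once keeps the values countable. *)
pose F (l : seq (X + token)) : set (X + token) :=
  (inr @` token_closure ht N (rights l) `|`
   ([set inl x0; inr (ord w0)] `|` inr @` tokens p) `|`
   if rights l is Gap e _ :: L then \bigcup_n (E (lefts l, n, L) e)
   else set0)%classic.
have cF l : countable (F l).
  apply: countableU; last first.
    case: (rights l) => [//|[h|c e M|c e|i n] L] //.
    by apply: bigcup_countable => // n _; have [] := EP (lefts l, n, L).
  apply: countableU; first exact/countable_image/token_closure_countable.
  apply: countableU; first exact/finite_set_countable/finite_set2.
  exact/countable_image/finite_set_countable/tokens_finite.
pose K A := hull F (inl @` A).
have KC A : closed_under F (K A) by exact: hull_closed.
(* The club consists of the countable sets to which the hull adds no element of [X]. *)
exists [set A | countable A /\ inl @^-1` K A = A].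
  split=> [A []//|A cA|c cP cinc].
    have AK : A `<=` inl @^-1` K A by move=> x Ax; apply: sub_hull; exists x.
    exists (inl @^-1` K A); split=> //; split.
      apply: countable_preimage; first by move=> x y [].
      by apply: hull_countable => //; exact: countable_image.
    rewrite eqEsubset; split=> [x|]; last first.
      by apply: preimage_subset; apply: hull_sub; exact: image_subset.
    by apply: hull_min => // _ [y Ky <-].
  split; first by apply: bigcup_countable => // n _; have [] := cP n.
  rewrite /K image_bigcup hull_bigcup; last by move=> n; exact: image_subset.
  rewrite preimage_bigcup; apply: eq_bigcup => // n _.
  by have [] := cP n.
move=> A [cA KA].
have base : F [::] `<=` K A by exact: KC.
split; first by rewrite -KA; apply: base; left; right; left; left.
have cS : countable (inr @^-1` K A : set token).
  apply: countable_preimage; first by move=> x y [].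
  by apply: hull_countable => //; exact: countable_image.
have clS : closed_under (token_closure ht N) (inr @^-1` K A).
  move=> L LK t Lt; apply: (KC A (map inr L)).
    by move=> _ /mapP[u uL ->]; exact: LK.
  by left; left; exists t => //; have := rightsE [::] L; rewrite /= => ->.
(* The master condition is [p] with the token of the hull [K A] adjoined. *)
have Kw : (inr @^-1` K A) (ord w0) by apply: base; left; right; left; right.
have [a [b [M [rM mS vM]]]] := closed_token W1 clS cS Kw.
have [|q qp qE] := add_closed_token rM mS vM (p := p).
  by move=> t pt; apply: base; left; right; right; exists t.
exists a, q; split=> // l n r x g lA rq Drxg ag.
have rMd : r (Md a b M) by apply: (condition_leP _ _ rq); rewrite qE; right.
have w0a : w0 < a by have [[//]|[]] := model_small mS Kw.
have [L LE] : exists L : seq token, [set t | r t /\ small a t] = [set` L].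
  by apply/finite_seqP; apply: sub_finite_set (tokens_finite r) => t [].
have LP t : t \in L <-> r t /\ small a t.
  by have := congr1 (@^~ t) LE => /= ->.
have LK t : t \in L -> K A (inr t).
  move=> /LP[rt ta]; rewrite -rM in mS.
  have := small_in_model rMd mS rt ta; by rewrite rM.
have [_ refl] := EP (l, n, L).
(* The reflected nodes must avoid not only [g] but all nodes of [r], since the latter decide
   compatibility. *)
pose G : set T := [set` g] `|` [set x | exists j m, r (Pr j m) /\ x \in N j].
have finG : finite_set G.
  by rewrite finite_setU; split; [exact: finite_seq|exact: finite_nodes].
have [|e ea|t /LP[]//|i m ri Li|s [x' [g' [Ds Ls sK Kx' [g'a sg]]]]] :=
    refl _ _ mS _ _ r x g Drxg _ _ ag G finG.
- by exists w0.
- move=> o Eo; apply: (KC A (map inl l ++ map inr (ord e :: L))).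
    move=> o'; rewrite mem_cat => /orP[] /mapP[y yl ->].
      by apply: sub_hull; exists y => //; exact: lA.
    move: yl; rewrite inE => /orP[/eqP->|/LK//].
    exact: (model_gap_in mS ea ea).
  by right; rewrite rightsE leftsE; exists n.
- rewrite leNgt; apply/negP => ia; move/negP: Li; apply.
  by apply/LP.
exists s, x', g'; split=> //.
- by rewrite -KA.
- apply: (amalgamate_model W1 htP htN rMd mS (lexx a) _ sK); first by rewrite rM.
    by move=> t rt ta; apply: Ls; apply/LP.
  move=> i m z j k y si nri zi rj aj yj.
  have [|_ sgy] := sg y; first by right; exists j, k.
  by apply: sgy si _ zi; apply/negP => /LP[].
move=> z z' zg z'g' /orP[zz'|z'z]; last first.
  by have [|sgz _] := sg z; [left|exact: sgz z'z].
have := g'a _ z'g'; rewrite ltNge (le_trans (ag _ zg)) //.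
exact: ht_le zz'.
Qed.

End Generic.

(** * Preservation of omega_1 and of Aronszajn trees *)

Section Preservation.
Context {dW : Order.disp_t} {W : orderType dW} (W1 : is_omega1 W).
Context {dT : Order.disp_t} {T : porderType dT} (TA : aronszajn_tree W T).
Context (ht : T -> W) (htP : forall x, has_height x (ht x)).
Context (N : W -> seq T) (htN : forall i x, x \in N i -> i <= ht x).
Notation condition := (condition N).
Implicit Types (p q r s : condition).

(** Suppose that [f] names an injection of omega_1 into omega. If [r'] forces that [x] has value
    [n], a compatible condition forces this of some member of the countable set [A]; injectivity
    puts [x] into [A], so omega_1 would be countable. *)
Lemma fis_omega1_condition p : fis_omega1 W p.
Proof.
have [wo nW cW] := W1; split; [split|].
- exact: fwell_ordered_ground.
- move=> q _ /fex_elim[r _ [f [[c1 c2] c3]]].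
  have [x0 _] := uncountable_nonempty nW.
  have [C [cC unbC _] CP] := generic_condition W1 TA htP htN x0
    (fun _ n s x _ => fmem (x, n) f s) r.
  have [A [CA _]] := unbC set0 (countable0 _).
  have [_ [a [q' [q'r gen]]]] := CP A CA.
  apply: nW; apply: sub_countableT (cC A CA) => x _.
  have xW : fmem x (check [set: W]) q' by apply/fmem_check.
  have [r' r'q' [n xn]] := fex_elim (c1 x q' q'r xW).
  have [//|//|s [x' [_ [Ax' x'n [t [tr' ts]] _]]]] :=
    gen [::] n r' x [::] _ r'q' xn _.
  suff -> : x = x' by [].
  apply: (c3 x x' n t); first exact: le_trans tr' (le_trans r'q' q'r).
  by split; [exact: fmem_persistent tr' xn|exact: fmem_persistent ts x'n].
- move=> a; apply: (@fcountable_ground _ _ _ _ [set b | b < a]) => //.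
  by move=> x q _ /fmem_check.
Qed.

(** Heights and levels are absolute. A name for a chain either can be bounded in height, hence is
    forced to be countable, or has a node [x] above the trace of the model. Reflecting [x] gives a
    compatible condition forcing into the chain a node incomparable with [x]. *)
Lemma faronszajn_tree_condition p : faronszajn_tree W T p.
Proof.
have [[wo _ lev clev] _] := TA; split; [split; [split; [split|]|]|].
- by move=> x; apply: fwell_ordered_ground; exact: wo.
- move=> x; apply: (@fex_intro _ _ _ _ (ht x)); first exact: fdensely_persistent.
  exact/fhas_height_ground/htP.
- move=> a; have [x xa] := lev a.
  apply: (@fex_intro _ _ _ _ x); first exact: fdensely_persistent.
  exact/fhas_height_ground.
- move=> a; apply: (@fcountable_ground _ _ _ _ [set x | has_height x a]) => //.
  move=> x q _ /fmem_fset h.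
  have [r _ xa] := fdensely_elim (h (@fdensely_persistent _ _ _)).
  by rewrite (fhas_height_abs W1 (htP x) xa); exact: htP.
move=> A q _ chA q' q'q.
have [[r [a [rq' bA]]]|nb] := pselect (exists r a,
    r <= q' /\ forall s x, s <= r -> fmem x A s -> ht x < a).
  suff [s sr sA] : exists2 s, s <= r & fcountable A s.
    have [u us fA] := fex_elim sA; exists u; split=> //.
    by apply: le_trans us _; exact: le_trans sr rq'.
  exists r => //; apply: (@fcountable_ground _ _ _ _ [set x | ht x < a]).
    by move=> x s sr xA; exact: bA sr xA.
  exact: countable_ht_lt.
have [C [_ unbC _] CP] := generic_condition W1 TA htP htN tt
  (fun _ _ s _ g => exists2 x, g = [:: x] & fmem x A s) q'.
have [B [CB _]] := unbC set0 (countable0 _).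
have [_ [a [u [uq' gen]]]] := CP B CB.
have [r [x [ru xA ax]]] : exists r x, [/\ r <= u, fmem x A r & a <= ht x].
  apply: contrapT => nr; apply: nb; exists u, a; split=> // s x su xA.
  by rewrite ltNge; apply/negP => ax; apply: nr; exists s, x.
have [|||s [_ [_ [_ [y -> yA] [t [tr ts]] inc]]]] := gen [::] 0%N r tt [:: x] _ ru.
- by [].
- by exists x.
- by move=> z; rewrite inE => /eqP->.
case: (inc x y); rewrite ?inE //.
apply: (chA x y t); last first.
  by split; [exact: fmem_persistent tr xA|exact: fmem_persistent ts yA].
by apply: le_trans tr _; apply: le_trans ru _; exact: le_trans uq' q'q.
Qed.

End Preservation.

(** * Properness *)

Section Mixing.
Context {d : Order.disp_t} {P : porderType d}.
Implicit Types (p q r s t u : P).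

Lemma compatible_sym p q : compatible p q -> compatible q p.
Proof. by move=> [r [rp rq]]; exists r. Qed.

Lemma maximal_antichain (Psi : P -> Prop) : exists A : set P,
  [/\ forall r, A r -> Psi r,
      forall r s, A r -> A s -> compatible r s -> r = s &
      forall q, Psi q -> exists2 r, A r & compatible q r].
Proof.
pose good (A : set P) := (forall r, A r -> Psi r) /\
  forall r s, A r -> A s -> compatible r s -> r = s.
have [|A [[APsi Aanti] Amax]] := @Zorn_bigcup _ (good : set (set P)).
  move=> F Fgood Ftot; split=> [r [B FB Br]|r s [B FB Br] [B' FB' B's]].
    by have [h _] := Fgood B FB; exact: h.
  have [h1 h2] := (Fgood B FB, Fgood B' FB').
  have [BB'|B'B] := Ftot B B' FB FB'.
    by have [_ h] := Fgood B' FB'; apply: h => //; exact: BB'.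
  by have [_ h] := Fgood B FB; apply: h => //; exact: B'B.
exists A; split=> // q Psiq; apply: contrapT => nq.
have nAq : ~ A q by move=> Aq; apply: nq; exists q => //; exists q.
apply: (Amax (A `|` [set q])%classic).
  split; first by move=> r Ar; left.
  by move=> /(_ q (or_intror erefl)).
split=> [r [/APsi//|->//]|r s [Ar|->] [As|->] //]; first exact: Aanti.
  by move=> /compatible_sym qr; case: nq; exists r.
by move=> qs; case: nq; exists s.
Qed.

(** The maximum principle: witnesses are chosen along a maximal antichain of conditions that have
    one, and glued into a single name. Below a member of the antichain the glued name agrees with
    the witness chosen there. *)
Lemma mixing (X : Type) (Psi : name P X -> P -> Prop) p :
  (forall q, q <= p -> exists2 r, r <= q & exists tau, Psi tau r) ->
  exists tau, forall q, q <= p -> exists t r sigma,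
    [/\ t <= q, t <= r, Psi sigma r &
      forall x u, u <= t -> fmem x tau u <-> fmem x sigma u].
Proof.
move=> dense.
have [A [APsi Aanti Amax]] := maximal_antichain (fun r => exists tau, Psi tau r).
have /choice[f fP] r : exists tau, A r -> Psi tau r.
  have [/APsi[tau tauP]|nA] := pselect (A r); first by exists tau.
  by exists set0.
exists [set xs | exists r, [/\ A r, xs.2 <= r & fmem xs.1 (f r) xs.2]].
move=> q /dense[q' q'q /Amax[r Ar [t [tq' tr]]]].
exists t, r, (f r); split=> //; [exact: le_trans q'q|exact: fP|].
move=> x u ut; split=> [xtau|xf v vu].
  apply: fmem_dense => v vu.
  have [w [wv [z [wz [r' [/= Ar' zr' xf]]]]]] := xtau v vu.
  exists w; split=> //; apply: (fmem_persistent wz).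
  suff -> : r = r' by [].
  apply: Aanti => //; exists w; split; last exact: le_trans wz zr'.
  by apply: le_trans wv _; apply: le_trans vu _; exact: le_trans ut tr.
exists v; split=> //; exists v; split=> //; exists r; split=> //=.
  by apply: le_trans vu _; exact: le_trans ut tr.
exact: fmem_persistent vu xf.
Qed.

Lemma fmem2_persistent (X : Type) (tau : name P X) (C : @name2 d P X) :
  persistent (fmem2 tau C).
Proof. exact: fdensely_persistent. Qed.

Lemma fmem2_ext (X : Type) (tau sigma : name P X) (C : @name2 d P X) p :
  (forall x q, q <= p -> fmem x tau q <-> fmem x sigma q) ->
  fmem2 tau C p -> fmem2 sigma C p.
Proof.
move=> e; apply: fdensely_sub => q qp [B [r [qr CB tB Bt]]].
exists B, r; split=> // x s sq.
  by move=> xs; apply: (tB x s sq); apply/e => //; exact: le_trans qp.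
by move=> xB; apply/e; [exact: le_trans qp|exact: (Bt x s sq)].
Qed.

Lemma fcountable_club_persistent (X : Type) (C : @name2 d P X) :
  persistent (fcountable_club C).
Proof.
move=> p q qp [[c1 c2] c3]; split; [split|].
- by move=> A r rq; apply: c1; exact: le_trans qp.
- by move=> A r rq; apply: c2; exact: le_trans qp.
- by move=> c r rq; apply: c3; exact: le_trans qp.
Qed.

(** The new injection sends [x] to 0 and shifts the values at all other elements by one. *)
Lemma fcountable_adjoin (X : Type) (A : name P X) x p : fcountable A p ->
  fcountable [set yr | A yr \/ yr.1 = x] p.
Proof.
apply: fdensely_sub => q _ [f [[c1 c2] c3]].
have adjP y r : y <> x ->
    fmem y [set yr | A yr \/ yr.1 = x] r -> fmem y A r.
  move=> yx; apply: fdensely_sub => s _ [t [st [Ayt|//]]].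
  by exists t.
pose g : name P (X * nat) := [set yr | (yr.1.1 = x /\ yr.1.2 = 0%N) \/
  (yr.1.1 <> x /\ exists2 m, yr.1.2 = m.+1 & f ((yr.1.1, m), yr.2))].
have gx n r : fmem (x, n) g r -> n = 0%N.
  by move=> /fdensely_elim[s _ [t [_ [[_ //]|[/= + _]]]]].
have gy y n r : y <> x -> fmem (y, n) g r -> exists2 m, n = m.+1 & fmem (y, m) f r.
  move=> yx yg; have [s _ [t [_ [[//]|[_ [m /= nm _]]]]]] := fdensely_elim yg.
  exists m => //; apply: fdensely_sub yg => u _ [v [uv [[//]|[_ [m' /= nm' yf]]]]].
  by exists v; split=> //; move: nm'; rewrite nm => -[->].
exists g; split; [split|].
- move=> y r rq yA s sr; have [->|yx] := pselect (y = x).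
    exists s; split=> //; exists 0%N => t ts; exists t; split=> //.
    by exists t; split=> //; left.
  have [t [ts [n yn]]] := c1 y r rq (adjP _ _ yx yA) s sr.
  exists t; split=> //; exists n.+1; apply: fdensely_sub yn => u _ [v [uv yf]].
  by exists v; split=> //; right; split=> //; exists n.
- move=> y n m r rq [yn ym]; have [yx|yx] := pselect (y = x).
    by move: yn ym; rewrite yx => /gx -> /gx ->.
  have [n' -> yn'] := gy _ _ _ yx yn; have [m' -> ym'] := gy _ _ _ yx ym.
  by congr _.+1; exact: (c2 y n' m' r rq).
- move=> y z n r rq [yn zn].
  have [yx|yx] := pselect (y = x); have [zx|zx] := pselect (z = x).
  + by rewrite yx zx.
  + have [m nm _] := gy _ _ _ zx zn.
    by move: yn; rewrite yx nm => /gx.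
  + have [m nm _] := gy _ _ _ yx yn.
    by move: zn; rewrite zx nm => /gx.
  have [n' nn' yn'] := gy _ _ _ yx yn; have [m' nm' zm'] := gy _ _ _ zx zn.
  apply: (c3 y z n' r rq); split=> //.
  by move: nm'; rewrite nn' => -[->].
Qed.

(** The unboundedness clause gives witnesses only densely often; mixing turns them into one name
    that [p] itself forces into [C]. *)
Lemma club_member (X : Type) (C : @name2 d P X) (A : name P X) p :
  fcountable_club C p -> fcountable A p ->
  exists B, [/\ fmem2 B C p, fcountable B p & fsubset A B p].
Proof.
move=> [[c1 c2] _] cA.
have [|B BP] := mixing (Psi := fun B r => fmem2 B C r /\ fsubset A B r) (p := p).
  move=> q qp; have [r [rq [B BP]]] := c2 A p (lexx p) cA q qp.
    by exists r => //; exists B.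
have BC : fmem2 B C p.
  apply: fdensely_idem => q /BP[t [r [sigma [tq tr [sC As] e]]]].
  exists t; split=> //; apply: fmem2_ext (fmem2_persistent tr sC).
  by move=> x u ut; rewrite (e x u ut).
exists B; split=> //; first exact: (c1 B p).
move=> x q qp xA; apply: fmem_dense => s sq.
have [t [r [sigma [ts tr [_ As] e]]]] := BP s (le_trans sq qp).
exists t; split=> //; apply/e => //; apply: (As x t tr).
by apply: fmem_persistent xA; exact: le_trans sq.
Qed.

End Mixing.

(** * Stationary sets of countable sets are preserved *)

Section Proper.
Context {dW : Order.disp_t} {W : orderType dW} (W1 : is_omega1 W).
Context {dT : Order.disp_t} {T : porderType dT} (TA : aronszajn_tree W T).
Context (ht : T -> W) (htP : forall x, has_height x (ht x)).
Context (N : W -> seq T) (htN : forall i x, x \in N i -> i <= ht x).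
Notation condition := (condition N).
Implicit Types (p q r s : condition).

(** To each list [l] a name [B l] for a member of [C] containing [l] is attached. By stationarity
    some [A] in [S] carries a generic condition, which forces [B l] into [A] for all [l] from [A].
    Along an enumeration of [A] these names increase to [A], which is thus forced into [C]. *)
Lemma fmem2_countable (X : eqType) (C : @name2 _ condition X)
    (S : set (set X)) p :
  ~ countable [set: X] -> countable_stationary S -> fcountable_club C p ->
  exists2 q, q <= p & exists2 A, S A & fmem2 (check A) C q.
Proof.
move=> nX [cS statS] clC; have [[c1 c2] c3] := clC.
have [x0 _] := uncountable_nonempty nX.
have [|B0 [B0C _ _]] := club_member (A := set0) clC.
  apply: (@fcountable_ground _ _ _ _ set0) => // x q _ xm.
  by have [r _ [s [_ []]]] := fdensely_elim xm.
have /choice[nxt nxtP] (Bx : name condition X * X) : exists B', fmem2 Bx.1 C p ->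
    [/\ fmem2 B' C p, fsubset Bx.1 B' p & fmem Bx.2 B' p].
  have [BC|nB] := pselect (fmem2 Bx.1 C p); last by exists set0.
  have [|B' [B'C _ AB']] := club_member
      (A := [set yr | Bx.1 yr \/ yr.1 = Bx.2]) clC.
    exact/fcountable_adjoin/(c1 Bx.1 p).
  exists B' => _; split=> // [y q qp yB|].
    apply: (AB' y q qp); apply: fdensely_sub yB => r _ [s [rs ys]].
    by exists s; split=> //; left.
  apply: (AB' Bx.2 p (lexx p)) => q qp; exists q; split=> //.
  by exists q; split=> //; right.
pose B := foldr (fun x B => nxt (B, x)) B0.
have BC l : fmem2 (B l) C p.
  by elim: l => [//|x l IH] /=; have [] := nxtP (B l, x) IH.
have BS x l : fsubset (B l) (B (x :: l)) p.
  by have [] := nxtP (B l, x) (BC l).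
have Bx x l : fmem x (B (x :: l)) p.
  by have [] := nxtP (B l, x) (BC l).
pose inj (f : name condition (X * nat)) (A : name condition X) : fprop condition :=
  ((\all x, (x \in A) ==> \some n, (x, n) \in f) &&
   (\all x y n, ((x, n) \in f) && ((y, n) \in f) ==> ⌜x = y⌝))%F.
have /choice[f fP] l : exists f, forall q, q <= p -> exists t r sigma,
    [/\ t <= q, t <= r, inj sigma (B l) r &
      forall xn u, u <= t -> fmem xn f u <-> fmem xn sigma u].
  apply: mixing => q qp.
  have [r [rq [g [[g1 _] g3]]]] := c1 (B l) p (lexx p) (BC l) q qp.
  by exists r => //; exists g.
have [K clK KP] := generic_condition W1 TA htP htN x0
  (fun l n s x _ => fmem (x, n) (f l) s) p.
have [A [SA /KP[Ax0 [a [q [qp gen]]]]]] := statS K clK.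
have [e eA] := countable_range (cS A SA) Ax0.
have eP n : A (e n) by rewrite -eA; exists n.
(* An element of [B l] has some value [n] under the injection [f l], and genericity finds an element
   of [A] with the same value. *)
have BA l y r : (forall x, x \in l -> A x) -> r <= q -> fmem y (B l) r -> A y.
  move=> lA rq yB; have [t [r0 [g [tr tr0 [g1 g2] gE]]]] := fP l r (le_trans rq qp).
  have [u [ut [n yn]]] := g1 y t tr0 (fmem_persistent tr yB) t (lexx t).
  have yn' : fmem (y, n) (f l) u by apply/gE.
  have [|//|s [x' [_ [Ax' x'n [v [vu vs]] _]]]] :=
    gen l n u y [::] lA _ yn' _.
    by apply: le_trans ut _; exact: le_trans tr rq.
  suff -> : y = x' by [].
  have vt := le_trans vu ut.
  apply: (g2 y x' n v (le_trans vt tr0)); split.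
    exact: fmem_persistent vu yn.
  by apply/gE => //; exact: fmem_persistent vs x'n.
pose l := fix l n := if n is m.+1 then e m :: l m else [::].
have lA n x : x \in l n -> A x.
  elim: n => [//|n IH] /=; rewrite inE => /orP[/eqP->|/IH//].
  exact: eP.
pose c : name condition (nat * X) :=
  fset (fun nx => fmem nx.2 (B (l nx.1))).
have cE n x u : fmem (n, x) c u <-> fmem x (B (l n)) u.
  split=> [/fmem_fset h|h]; first exact/fmem_dense/h/fmem_persistent.
  apply/fmem_fset; first exact: fmem_persistent.
  by apply: fdensely_intro h; exact: fmem_persistent.
have secE n x u : fmem x (fsection c n) u <-> fmem x (B (l n)) u.
  split=> [/fmem_fset h|/cE h].
    by apply/cE/fmem_dense/h/fmem_persistent.
  apply/fmem_fset; first exact: fmem_persistent.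
  by apply: fdensely_intro h; exact: fmem_persistent.
exists q => //; exists A => //.
apply: (@fmem2_ext _ _ _ (fset (fun x => fex (fun n => fmem (n, x) c)))).
  move=> x u uq; split=> [/fmem_fset h|/fmem_check].
    apply/fmem_check; have [|r ru rx] := fdensely_elim (h _).
      exact: fdensely_persistent.
    have [s sr [n /cE xB]] := fex_elim rx.
    apply: BA (lA n) _ xB; apply: le_trans sr _; exact: le_trans ru uq.
  rewrite -eA => -[n _ <-]; apply/fmem_fset; first exact: fdensely_persistent.
  apply: fdensely_intro; first exact: fdensely_persistent.
  apply: (fex_intro (i := n.+1)); first exact: fmem_persistent.
  by apply/cE; apply: fmem_persistent (Bx (e n) (l n)); exact: le_trans qp.
apply: (c3 c q qp _ q (lexx q)) => n.
  apply: fmem2_ext (fmem2_persistent qp (BC (l n))) => x u _.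
  by rewrite secE.
move=> x u uq /secE xB; apply/secE.
exact: (BS (e n) (l n) x u (le_trans uq qp) xB).
Qed.

Lemma proper_condition : proper_poset condition.
Proof.
(* The type [X] receives a classical equality test, needed for membership in lists. *)
move=> X; elim/Peq: X => X S nX statS p C q qp clC r rq.
have [s sr [A SA AC]] := fmem2_countable nX statS (fcountable_club_persistent rq clC).
by exists s; split=> //; exists A.
Qed.

End Proper.

(** * Preservation of the absence of stationary antichains *)

Section NoStationaryAntichain.
Context {dW : Order.disp_t} {W : orderType dW} (W1 : is_omega1 W).
Context {dT : Order.disp_t} {T : porderType dT} (TA : aronszajn_tree W T).
Context (TNS : ~ (exists A : set T, stationary_antichain W A)).
Context (ht : T -> W) (htP : forall x, has_height x (ht x)).
Context (N : W -> seq T) (htN : forall i x, x \in N i -> i <= ht x).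
Notation token := (token W).
Notation condition := (condition N).
Notation ord a := (Gap a a).
Implicit Types (t u : token) (a b c e i j : W) (M : nat -> token).
Implicit Types (p q r s : condition).

Lemma small_bounded a (L : seq token) : (exists c, c < a) ->
  (forall t, t \in L -> small a t) ->
  exists2 c, c < a & forall e t, c < e -> t \in L -> small e t.
Proof.
move=> a0; elim: L => [|t L IH] La; first by have [c ca] := a0; exists c.
have [|c ca cP] := IH; first by move=> u uL; apply: La; rewrite inE uL orbT.
have [e ea eP] : exists2 e, e < a & forall e', e < e' -> small e' t.
  have := La t; rewrite inE eqxx => /(_ isT).
  case: t {La} => [h|e e' M|e e'|i n] //=.
  - by move=> e'a; exists e'.
  - move=> [ea e'a]; exists (Order.max e e'); first by rewrite gt_max ea.
    by move=> e2; rewrite gt_max => /andP[].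
  - by move=> ia; exists i.
exists (Order.max c e); first by rewrite gt_max ca.
move=> e' u; rewrite gt_max => /andP[ce' ee']; rewrite inE => /orP[/eqP->|].
  exact: eP.
exact: cP.
Qed.

Section ForcedAntichain.
Context (A : name condition T) (r0 : condition).

(** This is the property of nodes that will be reflected below a node; [L] will be the part of a
    condition seen by a model. *)
Definition unboundedly_forced (L : seq token) : set T :=
  [set y | forall e, exists s, [/\ s <= r0, fmem y A s, [set` L] `<=` tokens s &
    forall i m, s (Pr i m) -> Pr i m \notin L -> e <= i]].

(** A node that is not unboundedly forced has a bound witnessing it; [h] dominates the bounds of the
    countably many nodes of each height or less. *)
Lemma bound_function L : exists h : W -> W, forall y s,
  s <= r0 -> fmem y A s -> [set` L] `<=` tokens s ->
  (forall i m, s (Pr i m) -> Pr i m \notin L -> h (ht y) <= i) ->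
  unboundedly_forced L y.
Proof.
have /choice[f fP] y : exists e, (exists s, [/\ s <= r0, fmem y A s,
    [set` L] `<=` tokens s &
    forall i m, s (Pr i m) -> Pr i m \notin L -> e <= i]) ->
    unboundedly_forced L y.
  have [Uy|nUy] := pselect (unboundedly_forced L y); first by exists (ht y).
  apply: contrapT => nf; apply: nUy => e; apply: contrapT => ne; apply: nf.
  by exists e.
have [h hP] := bounding W1 f (countable_ht_le W1 TA htP).
exists h => y s sr0 yA Ls hs; apply: fP; exists s; split=> // i m si Li.
by apply: le_trans (ltW (hP (ht y) y (lexx _))) _; exact: hs si Li.
Qed.

(** The club given by [reflecting_club] is traded for a function, so that models can contain it. *)
Lemma reflecting_function L : exists g : W -> W, forall x,
  (exists a, a < ht x) -> (forall a, a < ht x -> g a < ht x) ->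
  unboundedly_forced L x -> exists2 y, y < x & unboundedly_forced L y.
Proof.
have [C clC CP] := reflecting_club htP (unboundedly_forced L) TNS.
have [g gP] := club_closure_points clC.
by exists g => x x0 gx Ux; apply: CP => //; exact: gP.
Qed.

(** Witnesses for all [e] are chosen once and for all, so that models can be closed under them;
    beyond the second component of [sb] they obey Baumgartner's argument. *)
Lemma unboundedly_forced_family L y : exists sb : (W -> condition) * W,
  unboundedly_forced L y ->
  (forall e, [/\ sb.1 e <= r0, fmem y A (sb.1 e) &
    [set` L] `<=` tokens (sb.1 e)]) /\
  forall a, sb.2 <= a -> forall G : set T, finite_set G ->
    exists2 e, e < a & forall z, G z -> forall i n x,
      sb.1 e (Pr i n) -> Pr i n \notin L -> x \in N i -> ~ x <= z.
Proof.
have [Uy|nUy] := pselect (unboundedly_forced L y); last first.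
  by exists (fun=> r0, ht y).
have /choice[s sP] := Uy.
have [|//|b bP] := @unblocked _ _ W1 _ _ TA ht N htN [set` L] s (fun=> [::]).
  by move=> e i n si /negP; have [_ _ _] := sP e; apply.
exists (s, b) => _; split=> [e|a ba G finG]; first by have [] := sP e.
have [e ea eP] := bP a ba G finG; exists e => // z Gz i n x si Li xi.
by have [_ h] := eP z Gz; apply: h si _ xi; exact/negP.
Qed.

Lemma not_stationary_antichain : ~ fstationary_antichain W A r0.
Proof.
move=> [antiA statA].
have /choice[hb hbP] := bound_function.
have /choice[g gP] := reflecting_function.
have /choice[sb sbP] : forall Ly : seq token * T, _ :=
  fun Ly => unboundedly_forced_family Ly.1 Ly.2.
have [_ nW _] := W1; have [w0 _] := uncountable_nonempty nW.
(* A model [M] closed under [F1] contains [Fn (hb L)] for its lists [L], so the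
   interval of [Md a b M] exceeds [hb L a].  Hence any [r] containing this token
   and forcing a node of height [a] into [A] witnesses, through [hbP], that the
   node is unboundedly forced over the part of [r] below [a]. *)
pose F1 (l : seq token) : set token := (token_closure ht N l `|`
  [set` [:: ord w0; Fn (hb l); Fn (g l)]] `|`
  if l is Gap e c :: L then \bigcup_(y in [set y | ht y <= c])
    (ord (sb (L, y)).2 |` tokens ((sb (L, y)).1 e)) else set0)%classic.
have cF1 l : countable (F1 l).
  apply: countableU; last first.
    case: l => [//|[h|c e M|c e|i n] L] //.
    apply: bigcup_countable => [|y _]; first exact: countable_ht_le.
    apply: countableU; first exact: countable1.
    exact/finite_set_countable/tokens_finite.
  apply: countableU; first exact: token_closure_countable.
  exact/finite_set_countable/finite_seq.
have F1_closed S : closed_under F1 S -> closed_under (token_closure ht N) S.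
  by move=> clS l lS t lt; apply: clS lS _ _; left; left.
have F1_base S : closed_under F1 S -> S (ord w0).
  by move=> clS; apply: (clS [::]) => //; left; right; rewrite /= inE eqxx.
pose el a M := closed_under F1 (range M) /\ model ht N (range M) a.
have /choice[mu muP] (L : seq token) : exists t, exists a b M,
    [/\ t = Md a b M, el a M, valid t & [set` L] `<=` range M].
  pose S := hull F1 [set` L].
  have clS : closed_under F1 S by exact: hull_closed.
  have cS : countable S.
    by apply: hull_countable => //; exact/finite_set_countable/finite_seq.
  have [a [b [M [rM mS vM]]]] :=
    closed_token W1 (F1_closed S clS) cS (F1_base S clS).
  exists (Md a b M), a, b, M; split=> //; rewrite ?/el rM //.
  exact: sub_hull.
(* A set closed under [mu] as well contains elementary models of trace cofinal in its own. *)
pose F2 l := (F1 l `|` [set mu l])%classic.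
(* The traces of elementary models need not form a closed set in the extension;
   the traces of arbitrary models that are limits of them do. *)
pose cofinal a r := (exists c, c < a) /\
  forall c q, c < a -> q <= r -> exists2 s, s <= q &
    exists a' b M, [/\ s (Md a' b M), c < a', a' < a & el a' M].
pose psi a : fprop condition := fun r => (exists b M, r (Md a b M)) /\ cofinal a r.
have psi_persistent a : persistent (psi a).
  move=> r q qr [[b [M rM]] [a0 cof]]; split.
    by exists b, M; exact: (condition_leP _ _ qr).
  by split=> // c s ca sq; apply: cof => //; exact: le_trans qr.
have clubC : fclub (fset psi) r0.
  split.
    move=> a q qr0.
    pose S := hull F2 (tokens q `|` [set ord a])%classic.
    have clS : closed_under F2 S by exact: hull_closed.
    have clS1 : closed_under F1 S by move=> l lS t lt; apply: clS lS _ _; left.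
    have cS : countable S.
      apply: hull_countable.
        by move=> l; apply: countableU => //; exact: countable1.
      apply: countableU; last exact: countable1.
      exact/finite_set_countable/tokens_finite.
    have qS : tokens q `<=` S by move=> t qt; apply: sub_hull; left.
    have aS : S (ord a) by apply: sub_hull; right.
    have [d [b [M [rM mS vM]]]] := closed_token W1 (F1_closed S clS1) cS aS.
    have [r rq rE] := add_closed_token rM mS vM qS.
    have ad : a < d by have [[//]|[]] := model_small mS aS.
    have rMd : r (Md d b M) by rewrite rE; right.
    exists r; split=> //; exists d; split=> //.
    apply/fmem_fset => //; apply: fdensely_intro => //; split; first by exists b, M.
    split=> [|c u cd ur]; first by exists a.
    have uMd : u (Md d b M) by exact: (condition_leP _ _ ur).
    have [L LE] : exists L : seq token, [set t | u t /\ small d t] = [set` L].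
      by apply/finite_seqP; apply: sub_finite_set (tokens_finite u) => t [].
    have LP t : t \in L <-> u t /\ small d t.
      by have := congr1 (@^~ t) LE => /= ->.
    have LS t : t \in L -> S t.
      move=> /LP[ut td]; rewrite -rM in mS; rewrite -rM.
      exact: small_in_model uMd mS ut td.
    (* Listing [ord c] with [L] pushes the trace of the elementary model above [c]. *)
    have muS : S (mu (ord c :: L)).
      apply: (clS (ord c :: L)); last by right.
      by move=> t; rewrite inE => /orP[/eqP->|/LS//]; exact: (model_gap_in mS cd cd).
    have [a' [b' [M' [muE [elM' mM'] vM' LM']]]] := muP (ord c :: L).
    rewrite muE in muS vM'.
    (* The part of [u] below [d] is extended by the elementary model and then amalgamated with [u];
       this adds no pair. *)
    have [v uv vE] := restrict_condition u (small d).
    have [|s sv sE] := add_closed_token (erefl _) mM' vM' (p := v).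
      move=> t; rewrite vE => -[ut td]; apply: LM'; rewrite /= inE.
      by apply/orP; right; apply/LP.
    have ca' : c < a'.
      have cM' : range M' (ord c) by apply: LM'; rewrite /= inE eqxx.
      by have [[//]|[]] := model_small mM' cM'.
    have a'd : a' < d.
      apply: le_lt_trans (proj1 vM') _.
      by have [|[]] := model_small mS muS.
    have [||||s' [s'u s's]] := amalgamate_model W1 htP htN uMd mS (lexx d) _ (s := s).
    - by rewrite rM.
    - move=> t; rewrite sE => -[|->//]; rewrite vE => -[ut td].
      by apply: LS; apply/LP.
    - by move=> t ut td; rewrite sE; left; rewrite vE.
    - move=> i m x j k y; rewrite sE => -[|//].
      by rewrite vE => -[].
    exists s' => //; exists a', b', M'; split=> //.
    by apply: (condition_leP _ _ s's); rewrite sE; right.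
  (* At a limit [a], cofinality of elementary traces passes up from the smaller members; what
     remains is that [r] contains a model with trace [a]. *)
  move=> a q qr0 a0 q' q'q lim.
  have {a0} [c0 c0a] : exists c, c < a.
    by have [r _ [c]] := fex_elim a0; exists c.
  have limE c r : c < a -> r <= q' -> exists2 s, s <= r &
      exists e, [/\ c < e, e < a & psi e s].
    move=> ca rq'; have [s sr [e [[ce ea] eC]]] := fex_elim (lim c r rq' ca).
    have [u us ue] := fdensely_elim ((fmem_fset _ (psi_persistent e)).1 eC).
    by exists u; [exact: le_trans sr|exists e].
  suff psia : forall r, r <= q' -> psi a r.
    by apply/fmem_fset => //; apply: fdensely_intro => //; exact: psia.
  move=> r rq'; split; last first.
    split=> [|c u ca ur]; first by exists c0.
    have [s su [e [ce ea [_ [_ cof]]]]] := limE c u ca (le_trans ur rq').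
    have [v vs [a' [b [M [vM ca' a'e elM]]]]] := cof c s ce (lexx s).
    exists v; first exact: le_trans su.
    by exists a', b, M; split=> //; exact: lt_trans ea.
  apply: contrapT => nr.
  have [e0 e0a e0P] : exists2 e0, e0 < a &
      forall e b M, r (Md e b M) -> e < a -> e <= e0.
    pose end_of t := if t is Md e _ _
      then if e < a then ord e else ord c0 else ord c0.
    have [L LE] : exists L : seq token, end_of @` tokens r = [set` L].
      exact/finite_seqP/finite_image/tokens_finite.
    have LP t : (end_of @` tokens r) t <-> t \in L by rewrite LE.
    have [||e0 e0a e0P] := @small_bounded a L; first by exists c0.
      move=> t /LP[u _ <-]; case: u => [h|e b M|e b|i n] //=.
      by case: ifP.
    exists e0 => // e b M re ea; rewrite leNgt; apply/negP => e0e.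
    have [|] := e0P _ (ord e) e0e; last by rewrite ltxx.
    by apply/LP; exists (Md e b M) => //=; rewrite ea.
  (* Without a model of trace [a], the gap from [e0] to [a] could be added to [r]; it excludes all
     traces in between and contradicts that [a] is a limit. *)
  have [u ur uE] : exists2 u, u <= r &
      tokens u = (tokens r `|` [set Gap e0 a])%classic.
    apply: add_token => // -[h|e b M|e b|i n] re //=; split=> //.
    move=> /andP[e0e]; rewrite le_eqVlt => /orP[/eqP ea|ea].
      by apply: nr; exists b, M; rewrite -ea.
    by have := e0P _ _ _ re ea; rewrite leNgt e0e.
  have [s su [e [e0e ea [[b [M se]] _]]]] := limE e0 u e0a (le_trans ur rq').
  have sgap : s (Gap e0 a) by apply: (condition_leP _ _ su); rewrite uE; right.
  by apply: (model_gap se sgap); rewrite e0e ltW.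
have [q1 q1r0 [a [aS aC]]] := fex_elim (statA (fset psi) r0 (lexx r0) clubC).
move/fmem_fset: aS => /(_ (@fdensely_persistent _ _ _))/fdensely_elim[q2 q2q1].
move=> /fex_elim[q3 q3q2 [x [xA xa]]].
have {xa} xa := fhas_height_abs W1 (htP x) xa.
have q3q1 := le_trans q3q2 q2q1.
have [r rq3 [[b [M rM]] [a0 cof]]] :=
  fdensely_elim ((fmem_fset _ (psi_persistent a)).1 (fmem_persistent q3q1 aC)).
rewrite {}xa in rM a0 cof; set a' := ht x in rM a0 cof; clear a aC; rename a' into a.
have rr0 : r <= r0 by apply: le_trans rq3 _; exact: le_trans q3q1 q1r0.
have [L LE] : exists L : seq token, [set t | r t /\ small a t] = [set` L].
  by apply/finite_seqP; apply: sub_finite_set (tokens_finite r) => t [].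
have LP t : t \in L <-> r t /\ small a t.
  by have := congr1 (@^~ t) LE => /= ->.
have [|c1 c1a c1P] := small_bounded a0 (L := L); first by move=> t /LP[].
(* Going beyond [c1] keeps all tokens of [L] small at the trace [e], so that they belong to the
   elementary model. *)
have lim c : c < a -> exists s e M', [/\ s <= r, c < e, e < a, el e M' &
    range M' `<=` range M /\ [set` L] `<=` range M'].
  move=> ca; have [|s sr [e [b' [M' [sM']]]]] := cof (Order.max c c1) r _ (lexx r).
    by rewrite gt_max ca.
  rewrite gt_max => /andP[ce c1e] ea [clM' mM'].
  have sMd : s (Md a b M) by exact: (condition_leP _ _ sr).
  have [_ [_ /(_ _ _ _ erefl) MM']] := model_lt sM' sMd ea.
  exists s, e, M'; split=> //; split=> // t /LP[rt ta].
  apply: small_in_model sM' mM' _ (c1P e t c1e _); last by apply/LP.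
  exact: (condition_leP _ _ sr).
have Ux : unboundedly_forced L x.
  have [s [e [M' [sr _ _ [clM' _] [M'M LM']]]]] := lim c1 c1a.
  apply: (hbP L x r rr0 _ _ _).
  - exact: fmem_persistent xA.
  - by move=> t /LP[].
  move=> i m ri Li; apply: le_trans (ltW (pair_large rM ri _)).
    apply: model_bound rM _; apply: M'M; apply: (clM' L LM').
    by left; right; rewrite /= !inE eqxx orbT.
  by move=> ia; move/negP: Li; apply; apply/LP.
(* The traces of elementary models are cofinal in [a] and closed under [g L]; hence [a] is closed
   under [g L]. *)
have [y yx Uy] : exists2 y, y < x & unboundedly_forced L y.
  apply: (gP L x a0 _ Ux) => c ca.
  have [s [e [M' [_ ce ea [clM' mM'] [_ LM']]]]] := lim c ca.
  apply: lt_trans ea; apply: (model_fun mM' _ ce); apply: (clM' L LM').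
  by left; right; rewrite /= !inE eqxx !orbT.
have ya : ht y < a := ht_lt W1 htP yx.
have [sE sb_unblocked] := sbP (L, y) Uy.
(* The set [M] may fail to be closed under [F1], so the chosen conditions are located in elementary
   models inside it. *)
have family e : e < a -> exists s e' M', [/\ s <= r, e' < a, el e' M',
    range M' `<=` range M &
    (ord (sb (L, y)).2 |` tokens ((sb (L, y)).1 e))%classic `<=` range M'].
  move=> ea; have [|s [e' [M' [sr]]]] := lim (Order.max e (ht y)).
    by rewrite gt_max ea.
  rewrite gt_max => /andP[ee' ye'] e'a [clM' mM'] [M'M LM'].
  exists s, e', M'; split=> // t tsb; apply: (clM' (Gap e (ht y) :: L)).
    move=> u; rewrite inE => /orP[/eqP->|/LM'//].
    exact: model_gap_in mM' _ _ ee' ye'.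
  by right; exists y => /=.
have ba : (sb (L, y)).2 <= a.
  have [s [e' [M' [_ e'a [_ mM'] _ sbM']]]] := family _ ya.
  have [[be' _]|[]//] := model_small mM' (sbM' _ (or_introl erefl)).
  exact/ltW/(lt_trans be').
have [e ea eP] := sb_unblocked _ ba _ (finite_nodes r).
have [_ [e' [M' [_ e'a [_ mM'] M'M sbM']]]] := family _ ea.
have [yr0 yA Ls] := sE e.
have [|||t [tr ts]] :=
  amalgamate_model W1 htP htN rM mM' (ltW e'a) M'M (s := (sb (L, y)).1 e).
- by move=> t st; apply: sbM'; right.
- by move=> t rt ta; apply: Ls; apply/LP.
- move=> i n z j m z' zi nri zN rj aj z'N; apply: eP zi _ zN.
    by exists j, m.
  by apply/negP => /LP[].
(* The common extension [t] forces both [x] and its predecessor [y] into the antichain. *)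
apply: (antiA x y t (le_trans tr rr0) _ t (lexx t)).
  split; last by move=> u _ xy; rewrite xy ltxx in yx.
  split; last exact: fmem_persistent ts yA.
  exact: fmem_persistent tr (fmem_persistent rq3 xA).
by apply/orP; right; exact: ltW.
Qed.

End ForcedAntichain.

Lemma no_stationary_antichain_condition p :
  (~~ (\some A : name condition T, fstationary_antichain W A))%F p.
Proof. by move=> q _ /fex_elim[r _ [A /not_stationary_antichain]]. Qed.

End NoStationaryAntichain.

(** * Knasterness of the poset of finite antichains *)

(** The root has maximal size among the lists without repetition contained in uncountably many of
    the [s i] of one fixed length. Pairwise disjointness off the root is weakened to each outside
    element occurring countably often. *)
Lemma delta_system (I : Type) (T : eqType) (s : I -> seq T) :
  ~ countable [set: I] -> exists (root : seq T) (Y : set I),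
    [/\ ~ countable Y, forall i, Y i -> {subset root <= s i} &
      forall t, t \notin root -> countable [set i | Y i /\ t \in s i]].
Proof.
move=> nI; have [|n nH] := uncountable_bigcup (B := fun n => [set i | size (s i) = n]) nI.
  by move=> i _; exists (size (s i)).
set H := (_ `&` _)%classic in nH.
pose Q k := `[< exists r : seq T, [/\ uniq r, size r = k &
  ~ countable [set i | H i /\ {subset r <= s i}]] >].
have [||k /asboolP[r [ur rk nY]] kmax] := @ex_maxnP Q n.
- exists 0%N; apply/asboolP; exists [::]; split=> // cH; apply: nH.
  by apply: sub_countableT cH => i Hi.
- move=> k /asboolP[r [ur <- nY]]; have [i [[_ <-] ri]] := uncountable_nonempty nY.
  exact: uniq_leq_size.
exists r, [set i | H i /\ {subset r <= s i}]; split=> // [i []//|t tr].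
apply: contrapT => nt; have : Q k.+1.
  apply/asboolP; exists (t :: r); split; [by rewrite /= tr|by rewrite /= rk|].
  move=> c; apply: nt; apply: sub_countableT c => i [[Hi ri] ti]; split=> // u.
  by rewrite inE => /orP[/eqP->|/ri].
by move=> /kmax; rewrite ltnn.
Qed.

(** * Application of the forcing axiom *)

Section Main.
Context {dW : Order.disp_t} {W : orderType dW} (W1 : is_omega1 W).
Context {dT : Order.disp_t} {T : porderType dT} (TA : aronszajn_tree W T).

(** The filter contains pairs [Pr i n] with [i] unbounded. Countably many colours [n] cover these
    [i], so some colour has uncountably many, and directedness makes their nodes incomparable. *)
Lemma PFA_incomparable_subfamily (ht : T -> W) (N : W -> seq T) :
  ~ (exists A : set T, stationary_antichain W A) -> PFA_tree W T ->
  (forall x, has_height x (ht x)) ->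
  (forall i x, x \in N i -> i <= ht x) ->
  exists2 X : set W, ~ countable X &
    forall i j x y, X i -> X j -> i <> j -> x \in N i -> y \in N j -> ~ x >=< y.
Proof.
move=> TNS pfa htP htN.
pose D a := [set p : condition N | exists i n, a <= i /\ p (Pr i n)].
have [||||G [Gfilter GD]] := pfa _ (condition N) _ _ _ D.
- by exists (empty_condition N).
- exact: (proper_condition W1 TA htP htN).
- move=> p; split; last exact: (no_stationary_antichain_condition W1 TA TNS htP htN).
  split; first exact: (fis_omega1_condition W1 TA htP htN).
  exact: (faronszajn_tree_condition W1 TA htP htN).
- move=> a p.
  (* For density, an index beyond all intervals of [p] and a colour that [p] does not use can be
     added as a pair without conflict. *)
  pose top (t : token W) := match t with Md _ b _ => b | _ => a end.
  have [i iP] : exists i, forall b, (b = a \/ exists2 t, p t & b = top t) -> b < i.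
    apply: (countable_bounded W1).
    apply: sub_countableT (countableU (countable1 a) (countable_image top
      (finite_set_countable (tokens_finite p)))) => b [->|[t pt ->]]; first by left.
    by right; exists t.
  pose colour (t : token W) := if t is Pr _ n then n else 0%N.
  have [n nP] : exists n, forall t, p t -> (colour t < n)%N.
    have [l lE] : exists l : seq (token W), tokens p = [set` l].
      exact/finite_seqP/tokens_finite.
    exists (\max_(t <- l) colour t).+1 => t; rewrite lE /= ltnS => tl.
    exact: leq_bigmax_seq.
  have [q qp qE] : exists2 q : condition N, q <= p &
      tokens q = (tokens p `|` [set Pr i n])%classic.
    apply: add_token => // -[h|c e M|c e|j m] pt //=.
      split=> //; have ei : e < i by apply: iP; right; exists (Md c e M).
      by rewrite [i <= e]leNgt ei andbF.
    by split=> nm; have := nP _ pt; rewrite /= ?nm -?nm ltnn.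
  exists q; split=> //; exists i, n; split; last by rewrite qE; right.
  by apply/ltW/iP; left.
have [_ _ Gdir] := Gfilter.
have [||n nX] := uncountable_bigcup (A := [set i | exists p n, G p /\ p (Pr i n)])
    (B := fun n => [set i | exists2 p, G p & p (Pr i n)]).
- apply: (unbounded_uncountable W1) => b; have [p [Gp [i [n [bi pi]]]]] := GD b.
  by exists i => //; exists p, n.
- by move=> i [p [n [Gp pi]]]; exists n, p.
eexists; first exact: nX.
move=> i j x y [_ [p Gp pi]] [_ [q Gq qj]] ij xi yj.
have [r [_ rp rq]] := Gdir p q Gp Gq.
by apply: pair_pair (condition_leP _ _ rp _ pi) (condition_leP _ _ rq _ qj) ij _ _ xi yj.
Qed.

Lemma knaster_finite_antichain :
  ~ (exists A : set T, stationary_antichain W A) -> PFA_tree W T ->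
  knaster W (finite_antichain T).
Proof.
move=> TNS pfa p; have [[_ /choice[ht htP] _ _] _] := TA.
have /choice[s sE] i : exists s : seq T, (p i : set T) = [set` s].
  exact/finite_seqP/antichain_finite.
have sP i x : antichain_set (p i) x <-> x \in s i by rewrite sE.
have [_ nW _] := W1.
have [root [Y [nY rootY Yroot]]] := delta_system s nW.
have /choice[g gP] a : exists i, [/\ Y i, a < i &
    forall t, t \in s i -> t \notin root -> a <= ht t].
  (* These are the indices with a node of height below [a] off the root: countably many nodes, each
     occurring countably often. *)
  pose low := \bigcup_(t in [set t | t \notin root /\ ht t < a])
    [set i | Y i /\ t \in s i].
  have cl : countable low.
    apply: bigcup_countable => [|t [/Yroot//]].
    by apply: sub_countableT (countable_ht_lt W1 TA htP a) => t [].
  have nYl : ~ countable (Y `\` low).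
    move=> c; apply: nY; apply: sub_countableT (countableU c cl) => i Yi.
    by have [|] := pselect (low i); [right|left].
  have [i [Yi nl] ai] := uncountable_unbounded W1 a nYl.
  exists i; split=> // t ti tr; rewrite leNgt; apply/negP => ta.
  by apply: nl; exists t.
have [|X nX XP] := PFA_incomparable_subfamily
    (N := fun a => [seq t <- s (g a) | t \notin root]) TNS pfa htP.
  move=> i x; rewrite mem_filter => /andP[xr xs].
  by have [_ _] := gP i; apply.
exists (g @` X); split.
  apply: (unbounded_uncountable W1) => b.
  have [a Xa ba] := uncountable_unbounded W1 b nX.
  by exists (g a); [exists a|have [_ ag _] := gP a; exact/ltW/(lt_trans ba)].
have cross i j x y : X i -> X j -> i <> j -> antichain_set (p (g i)) x ->
    antichain_set (p (g j)) y -> x <> y ->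
    ~ x >=< y.
  move=> Xi Xj ij xi yj xy.
  have [Yi _ _] := gP i; have [Yj _ _] := gP j.
  (* A root node belongs to both conditions, so its incomparability is inherited from one of them;
     other nodes are covered by the choice of [X]. *)
  have [xr|xr] := boolP (x \in root).
    by apply: (antichain_incomparable (f := p (g j))) => //; apply/sP/rootY.
  have [yr|yr] := boolP (y \in root).
    by apply: (antichain_incomparable (f := p (g i))) => //; apply/sP/rootY.
  by apply: (XP i j); rewrite ?mem_filter ?xr ?yr //=; apply/sP.
move=> _ _ [_ [i Xi <-] <-] [_ [j Xj <-] <-].
have [<-|ij] := pselect (i = j); first by exists (p (g i)).
have fU : finite_set ((p (g i) : set T) `|` (p (g j) : set T))%classic.
  by rewrite finite_setU; split; exact: antichain_finite.
have aU : is_antichain ((p (g i) : set T) `|` (p (g j) : set T))%classic.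
  move=> x y [xi|xj] [yi|yj] xy.
  - exact: antichain_incomparable xi yi xy.
  - exact: (cross i j).
  - by apply: (cross j i) => // ji; apply: ij.
  - exact: antichain_incomparable xj yj xy.
exists (FiniteAntichain fU aU).
by split; apply/asboolP => x /= xp; [left|right].
Qed.

Lemma not_stationarily_knaster_finite_antichain :
  ~ (exists A : set T, stationary_antichain W A) ->
  ~ stationarily_knaster W (finite_antichain T).
Proof.
move=> TNS sK; have [[_ _ /choice[x xP] _] _] := TA.
have a1 a : is_antichain [set x a] by move=> y z -> ->.
have [_ nW _] := W1; have [w0 _] := uncountable_nonempty nW.
have [|R [statR _ linkR]] :=
  sK setT (fun a => FiniteAntichain (finite_set1 (x a)) (a1 a)).
  by move=> C [/(_ w0)[b [_ Cb]] _]; exists b.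
apply: TNS; exists (x @` R); split.
  move=> _ _ [a Ra <-] [b Rb <-] ab.
  have [|//|r [/asboolP ra /asboolP rb]] := linkR
    (FiniteAntichain (finite_set1 (x a)) (a1 a))
    (FiniteAntichain (finite_set1 (x b)) (a1 b)); [by exists a|by exists b|].
  apply: (antichain_incomparable (f := r)) => //; [exact: ra|exact: rb].
move=> C /statR[a [Ra Ca]]; exists a; split=> //.
by exists (x a); split=> //; exists a.
Qed.

End Main.

Theorem theorem4p13 (dW : Order.disp_t) (W : orderType dW)
    (dT : Order.disp_t) (T : porderType dT) :
  is_omega1 W ->
  aronszajn_tree W T ->
  ~ (exists A : set T, stationary_antichain W A) ->
  PFA_tree W T ->
  knaster W (finite_antichain T) /\ ~ stationarily_knaster W (finite_antichain T).
Proof.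
move=> W1 TA TNS pfa; split; first exact: knaster_finite_antichain.
exact: not_stationarily_knaster_finite_antichain.
Qed.
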